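(* Let $A$ be a unital operator algebra containing a $C^*$-algebra $D$ unitally (i.e. with common identity). Let $\Phi,\Psi:A\to D$ be $D$-characters. The following are equivalent: (1) $\|\Phi-\Psi\|<2$. (2) $\|\Phi|_{\mathrm{Ker}\,\Psi}\|<1$. (3) There is a constant $M>0$ with $\rho(\Phi(a),\Psi(a))\le M$ for all $a\in A$ with $\|a\|<1$. (4) If $(a_n)$ is a sequence in the closed unit ball $\mathrm{Ball}(A)$ of $A$ with $\|\Phi(a_n)\|\to1$, then $\|\Psi(a_n)\|\to1$. If $A$ is a unital subalgebra of a unital $C^*$-algebra $C$, and if $D$ is represented as a $C^*$-algebra nondegenerately on a Hilbert space $H$, then the equivalent conditions (1), (2), (3), (4) are implied by each of the following: (5) There are positive constants $c,d$ and completely positive maps $\tilde\Phi,\tilde\Psi:C\to B(H)$ extending $\Phi,\Psi$ respectively, with $\tilde\Phi\le c\tilde\Psi$ and $\tilde\Psi\le d\tilde\Phi$. (6) (Harnack inequality) There are positive constants $c,d$ with $\Phi\preccurlyeq c\Psi$ and $\Psi\preccurlyeq d\Phi$ on $A$. If $D$ is one-dimensional, then (5) and (6) are equivalent to conditions (1), (2), (3), (4).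
   Context: A unital operator algebra is a norm-closed subalgebra $A$ of a unital $C^*$-algebra (equivalently of $B(K)$ for a Hilbert space $K$) containing its identity. ''Containing $D$'' means that $D$ is a $C^*$-subalgebra (closed selfadjoint subalgebra) contained in $A$. A $D$-character of $A$ is a contractive unital homomorphism $A\to D$ which restricts to the identity map on $D$ (it is automatically a $D$-bimodule map). For strict contractions $x,y$ on a Hilbert space (elements of norm $<1$ of a unital $C^*$-algebra) the hyperbolic distance is $$\rho(x,y)=\tanh^{-1}\left\|(1-xx^* )^{-1/2}(x-y)(1-x^*y)^{-1}(1-x^*x)^{1/2}\right\|.$$ In (5), $\tilde\Phi\le c\tilde\Psi$ means $\tilde\Phi(x)\le c\tilde\Psi(x)$ for all $x\in C_+$. In (5) $D$ is regarded as a subset of $B(H)$ via its representation. In (6), $\preccurlyeq$ is the real positive ordering: $\Phi\preccurlyeq c\Psi$ means that $c\Psi-\Phi$ is real positive on $A$, where a map $T$ on $A$ is real positive if $T(a)+T(a)^*\ge0$ whenever $a\in A$ and $a+a^*\ge0$. *)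

(* Defs.v *)
From HB Require Import structures.
From mathcomp Require Import all_boot all_order all_algebra.
From mathcomp Require Import all_classical all_reals all_analysis.
From mathcomp Require Import complex.

Set Implicit Arguments.
Unset Strict Implicit.
Unset Printing Implicit Defensive.

Import Order.TTheory GRing.Theory Num.Theory.
Import numFieldNormedType.Exports.

Local Open Scope classical_set_scope.
Local Open Scope complex_scope.
Local Open Scope ring_scope.

(* Unital complex C*-algebras, with 1 != 0. The library norm takes its values
   in R[i]; see [normR]. The multiplication is part of this mixin because the
   hierarchy of the library has no join of its ring structures with its normed
   modules; the ring and algebra structures are instantiated just below, so
   that the usual notation applies. *)
HB.mixin Record isCStarAlgebra (R : realType) (A : Type)
    & CompleteNormedModule R[i] A := {
  cstar_one : A;
  cstar_mul : A -> A -> A;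
  cstar_mulA : associative cstar_mul;
  cstar_mul1l : left_id cstar_one cstar_mul;
  cstar_mul1r : right_id cstar_one cstar_mul;
  cstar_mulDl : left_distributive cstar_mul +%R;
  cstar_mulDr : right_distributive cstar_mul +%R;
  cstar_one_neq0 : cstar_one != 0;
  cstar_scaleAl : forall (k : R[i]) (x y : A),
    k *: cstar_mul x y = cstar_mul (k *: x) y;
  cstar_scaleAr : forall (k : R[i]) (x y : A),
    k *: cstar_mul x y = cstar_mul x (k *: y);
  star : A -> A;
  starK : involutive star;
  starD : {morph star : x y / x + y};
  starZ : forall (k : R[i]) (x : A), star (k *: x) = Num.conj k *: star x;
  starM : forall x y : A, star (cstar_mul x y) = cstar_mul (star y) (star x);
  cstar_normM : forall x y : A, `|cstar_mul x y| <= `|x| * `|y|;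
  cstar_norm : forall x : A, `|cstar_mul (star x) x| = `|x| ^+ 2
}.

#[short(type="cstarAlgType")]
HB.structure Definition CStarAlgebra (R : realType) :=
  {A of CompleteNormedModule R[i] A & isCStarAlgebra R A}.

Section CStarAlgebraInstances.
Variables (R : realType) (A : cstarAlgType R).

#[non_forgetful_inheritance]
HB.instance Definition _ := GRing.Zmodule_isNzRing.Build A
  (@cstar_mulA R A) (@cstar_mul1l R A) (@cstar_mul1r R A)
  (@cstar_mulDl R A) (@cstar_mulDr R A) (@cstar_one_neq0 R A).

#[non_forgetful_inheritance]
HB.instance Definition _ :=
  GRing.Lmodule_isLalgebra.Build R[i] A (@cstar_scaleAl R A).

#[non_forgetful_inheritance]
HB.instance Definition _ :=
  GRing.Lalgebra_isAlgebra.Build R[i] A (@cstar_scaleAr R A).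

End CStarAlgebraInstances.

(* The inner product is linear in its first argument. *)
HB.mixin Record isHilbertSpace (R : realType) (H : Type)
    & CompleteNormedModule R[i] H := {
  inner : {dot H for (@Num.conj R[i])};
  inner_norm : forall h : H, inner h h = `|h| ^+ 2
}.

#[short(type="hilbertType")]
HB.structure Definition HilbertSpace (R : realType) :=
  {H of CompleteNormedModule R[i] H & isHilbertSpace R H}.

Definition normR (R : realType) (V : normedModType R[i]) (x : V) : R :=
  complex.Re `|x|.

Section CStar.
Variables (R : realType) (C : cstarAlgType R).
Implicit Types (A D S : set C) (x y : C) (T Phi Psi : C -> C).

Definition cnonneg x : Prop := exists y, x = star y * y.

(* The inverse of x, if x is invertible. *)
Definition cinv x : C := xget 0 [set y | x * y = 1 /\ y * x = 1].

(* The positive square root of x, if x is positive. *)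
Definition csqrt x : C := xget 0 [set y | cnonneg y /\ y * y = x].

(* Inverse hyperbolic tangent, meaningful for -1 < r < 1. *)
Definition atanh (r : R) : R := ln ((1 + r) / (1 - r)) / 2.

(* Meaningful for `|x| < 1 and `|y| < 1. *)
Definition hyp_dist x y : R :=
  atanh (normR (cinv (csqrt (1 - x * star x)) * (x - y)
                * cinv (1 - star x * y) * csqrt (1 - star x * x))).

(* Only the norm topology, the unit and the operations of C are involved:
   A contains the unit of C and is not required to be selfadjoint. *)
Definition unital_operator_algebra A : Prop :=
  closed A /\ GRing.subalg_closed (mem A).

Definition unital_cstar_subalgebra D : Prop :=
  unital_operator_algebra D /\ (forall x, D x -> D (star x)).

(* Maps with domain A are represented by functions on the ambient algebra C,
   of which only the values on A matter. *)
Record D_character A D Phi : Prop := DCharacter {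
  dchar_codom : forall a, A a -> D (Phi a);
  dchar_linear : forall (k : R[i]) a b, A a -> A b ->
    Phi (k *: a + b) = k *: Phi a + Phi b;
  dchar_mul : forall a b, A a -> A b -> Phi (a * b) = Phi a * Phi b;
  dchar_unit : Phi 1 = 1;
  dchar_contr : forall a, A a -> `|Phi a| <= `|a|;
  dchar_id : forall d, D d -> Phi d = d
}.

(* Operator norm of the restriction of T to the subspace S. *)
Definition opnorm_on S T : \bar R :=
  ereal_sup [set (normR (T x))%:E | x in S `&` [set x | `|x| <= 1]].

Definition real_positive_on A T : Prop :=
  forall a, A a -> cnonneg (a + star a) -> cnonneg (T a + star (T a)).

Definition harnack_equivalent A Phi Psi : Prop :=
  exists c d : R, [/\ 0 < c, 0 < d,
    real_positive_on A (fun a => c%:C *: Psi a - Phi a) &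
    real_positive_on A (fun a => d%:C *: Phi a - Psi a)].

Definition one_dimensional D : Prop :=
  exists2 v : C, v != 0 & D = [set k *: v | k in [set: R[i]]].

(* Positive elements of the C*-algebra M_n(C). *)
Definition mx_nonneg n (X : 'M[C]_n) : Prop :=
  exists Y : 'M[C]_n, X = (map_mx star Y)^T *m Y.

End CStar.

Section Operators.
Variables (R : realType) (C : cstarAlgType R) (H : hilbertType R).
Implicit Types (A D : set C) (Phi Psi : C -> C).
(* B(H) is the set of functions H -> H satisfying [bounded_op]. *)
Implicit Types (t : H -> H) (T pi : C -> H -> H).

Definition bounded_op t : Prop := linear t /\ continuous t.

Definition op_nonneg t : Prop := forall h, 0 <= inner (t h) h.

(* M_n(B(H)) is identified with B(H^n), the matrix (t_ij) being positive when
   its quadratic form on H^n is. *)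
Definition completely_positive T : Prop :=
  [/\ linear T, forall x, bounded_op (T x) &
    forall n (X : 'M[C]_n), mx_nonneg X -> forall h : 'I_n -> H,
      0 <= \sum_(i < n) \sum_(j < n) inner (T (X i j) (h j)) (h i)].

(* Faithful nondegenerate *-representation of D on H. *)
Record represented_nondegenerately D pi : Prop := Represented {
  rep_bounded : forall d, D d -> bounded_op (pi d);
  rep_linear : forall (k : R[i]) d e, D d -> D e ->
    pi (k *: d + e) = k *: pi d + pi e;
  rep_mul : forall d e, D d -> D e -> pi (d * e) = pi d \o pi e;
  rep_star : forall d, D d -> forall h k,
    inner (pi (star d) h) k = inner h (pi d k);
  rep_faithful : forall d, D d -> pi d = 0 -> d = 0;
  rep_nondegenerate :
    closure [set v : H | exists n (d : 'I_n -> C) (h : 'I_n -> H),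
      (forall i, D (d i)) /\ v = \sum_(i < n) pi (d i) (h i)] = setT
}.

Definition cp_harnack_equivalent A pi Phi Psi : Prop :=
  exists (c d : R) (Phi' Psi' : C -> H -> H),
    [/\ 0 < c /\ 0 < d,
        completely_positive Phi' /\ completely_positive Psi',
        forall a, A a -> Phi' a = pi (Phi a) /\ Psi' a = pi (Psi a),
        forall x, cnonneg x -> op_nonneg (c%:C *: Psi' x - Phi' x) &
        forall x, cnonneg x -> op_nonneg (d%:C *: Phi' x - Psi' x)].

End Operators.

(* Main.v *)
Require Import Defs.
From HB Require Import structures.
From mathcomp Require Import all_boot all_order all_algebra.
From mathcomp Require Import all_classical all_reals all_analysis.
From mathcomp Require Import complex.
From mathcomp Require Import ring lra.

Set Implicit Arguments.
Unset Strict Implicit.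
Unset Printing Implicit Defensive.

Import Order.TTheory GRing.Theory Num.Theory.
Import numFieldNormedType.Exports.

Local Open Scope classical_set_scope.
Local Open Scope complex_scope.
Local Open Scope ring_scope.

(* Everything rests on order arguments in C.  The cone of positive elements is
   described by the norm condition |t - x| <= t, and the elements y^* y are shown to
   lie in it (Fukamiya-Kaplansky) from the square root of 1 - a alone, obtained by the
   iteration b := (a + b^2) / 2.

   A Moebius map M_d centred at d in D preserves the unit ball of A and commutes with
   D-characters.  Taking d = Phi a turns the hyperbolic distance of Phi a and Psi a
   into the norm of an element of Psi (Ball (Ker Phi)), hence the equivalence of (3)
   with the condition (2) for the exchanged pair; taking d = Psi a, x = Phi a and
   y = Psi a, condition (2) gives 1 - x^* x >= k (1 - x^* y) (1 - y^* x) with k > 0,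
   which yields both |x - y| <= 2 - eps and (4).  Conversely, for a in Ker Psi with
   Phi a = e >= 0, the scalar Moebius transform b of a satisfies
   Phi b - Psi b = (1 - r^2) e (1 - r e)^-1, whose norm tends to 2 as |e| and r tend
   to 1.  Since (1) is symmetric in Phi and Psi, so is (2).

   (5) and (6), applied to 1 - a with a in Ker Psi, bound Re Phi a away from 1.  In the
   scalar case (2) gives the classical Harnack inequality through Cayley transforms,
   and (6) gives (5) by Hahn-Banach extension of c Psi - Phi and d Phi - Psi. *)

(** * Reflexive identities in noncommutative algebras *)

(** Noncommutativity of [D] shapes the argument: [Phi a] need not even be normal, and a Moebius
    transform involves two different defect operators of its centre. Two devices cope with this. If
    [a] lies in the kernel of [Psi], so does [star (Phi a) * a], whose image under [Phi] is the
    positive element [star (Phi a) * Phi a]; what is then built from that image commutes with it.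
    Elsewhere a scalar estimate is rewritten as a sum of positive terms, hence as a polynomial
    identity in noncommuting variables, and closure of the cone under sums and conjugation does the
    rest. No spectrum and no functional calculus enter: roots and inverses are limits of explicit
    iterations, and they commute with a given element because the iteration runs inside its
    commutant. *)

Inductive ncexpr (K : Type) :=
| NCVar of nat | NCZero | NCOne
| NCAdd of ncexpr K & ncexpr K | NCOpp of ncexpr K
| NCMul of ncexpr K & ncexpr K | NCScale of K & ncexpr K.
Arguments NCVar {K}. Arguments NCZero {K}. Arguments NCOne {K}.

Section NCAlg.
Variables (K : comNzRingType) (V : algType K) (env : seq V).

Fixpoint nc_eval (e : ncexpr K) : V :=
  match e with
  | NCVar n => nth 0 env n
  | NCZero => 0
  | NCOne => 1
  | NCAdd e1 e2 => nc_eval e1 + nc_eval e2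
  | NCOpp e1 => - nc_eval e1
  | NCMul e1 e2 => nc_eval e1 * nc_eval e2
  | NCScale k e1 => k *: nc_eval e1
  end.

Definition nc_mono (m : K * seq nat) : V :=
  m.1 *: foldr (fun n v => nth 0 env n * v) 1 m.2.

Fixpoint nc_sum (s : seq (K * seq nat)) : V :=
  if s is m :: s' then nc_mono m + nc_sum s' else 0.

Fixpoint nc_scale (k : K) (s : seq (K * seq nat)) :=
  if s is m :: s' then (k * m.1, m.2) :: nc_scale k s' else [::].

Fixpoint nc_mul1 (m : K * seq nat) (s : seq (K * seq nat)) :=
  if s is m' :: s' then (m.1 * m'.1, m.2 ++ m'.2) :: nc_mul1 m s' else [::].

Fixpoint nc_mul (s t : seq (K * seq nat)) :=
  if s is m :: s' then nc_mul1 m t ++ nc_mul s' t else [::].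

Fixpoint nc_norm (e : ncexpr K) : seq (K * seq nat) :=
  match e with
  | NCVar n => [:: (1, [:: n])]
  | NCZero => [::]
  | NCOne => [:: (1, [::])]
  | NCAdd e1 e2 => nc_norm e1 ++ nc_norm e2
  | NCOpp e1 => nc_scale (-1) (nc_norm e1)
  | NCMul e1 e2 => nc_mul (nc_norm e1) (nc_norm e2)
  | NCScale k e1 => nc_scale k (nc_norm e1)
  end.

Fixpoint nc_weq (u v : seq nat) :=
  match u, v with
  | [::], [::] => true
  | m :: u', n :: v' => eqn m n && nc_weq u' v'
  | _, _ => false
  end.

Fixpoint nc_insert (m : K * seq nat) (s : seq (K * seq nat)) :=
  if s is m' :: s' then
    if nc_weq m.2 m'.2 then (m.1 + m'.1, m.2) :: s' else m' :: nc_insert m s'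
  else [:: m].

Fixpoint nc_collect (s : seq (K * seq nat)) :=
  if s is m :: s' then nc_insert m (nc_collect s') else [::].

(** A proposition, not a boolean: vanishing of the coefficients is not decided by computation but
    left to [ring] or [field]. *)
Fixpoint nc_null (s : seq (K * seq nat)) : Prop :=
  if s is m :: s' then m.1 = 0 /\ nc_null s' else True.

Lemma nc_sum_cat s t : nc_sum (s ++ t) = nc_sum s + nc_sum t.
Proof. by elim: s => [|m s ih] /=; rewrite ?add0r // ih addrA. Qed.

Lemma nc_sum_scale k s : nc_sum (nc_scale k s) = k *: nc_sum s.
Proof.
by elim: s => [|m s ih] /=; rewrite ?scaler0 // ih /nc_mono /= -scalerA scalerDr.
Qed.

Lemma nc_mono_cat (k l : K) u v :
  nc_mono (k * l, u ++ v) = nc_mono (k, u) * nc_mono (l, v).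
Proof.
rewrite /nc_mono /= -scalerAl -scalerAr scalerA; congr (_ *: _).
by elim: u => [|n u ih] /=; rewrite ?mul1r // ih mulrA.
Qed.

Lemma nc_sum_mul1 m s : nc_sum (nc_mul1 m s) = nc_mono m * nc_sum s.
Proof.
elim: s => [|m' s ih] /=; rewrite ?mulr0 // ih mulrDr; congr (_ + _).
by rewrite nc_mono_cat -!surjective_pairing.
Qed.

Lemma nc_sum_mul s t : nc_sum (nc_mul s t) = nc_sum s * nc_sum t.
Proof.
by elim: s => [|m s ih] /=; rewrite ?mul0r // nc_sum_cat nc_sum_mul1 ih mulrDl.
Qed.

Lemma nc_sum_norm e : nc_sum (nc_norm e) = nc_eval e.
Proof.
elim: e => /= [n|||e1 ih1 e2 ih2|e ih|e1 ih1 e2 ih2|k e ih].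
- by rewrite addr0 /nc_mono /= scale1r mulr1.
- by [].
- by rewrite addr0 /nc_mono /= scale1r.
- by rewrite nc_sum_cat ih1 ih2.
- by rewrite nc_sum_scale ih scaleN1r.
- by rewrite nc_sum_mul ih1 ih2.
- by rewrite nc_sum_scale ih.
Qed.

Lemma nc_weqP u v : nc_weq u v -> u = v.
Proof. by elim: u v => [|m u ih] [|n v] //= /andP[/eqnP -> /ih ->]. Qed.

Lemma nc_sum_insert m s : nc_sum (nc_insert m s) = nc_mono m + nc_sum s.
Proof.
elim: s => [|m' s ih] //=.
case: ifP => [/nc_weqP mm'|_] /=; last by rewrite ih addrCA.
by rewrite /nc_mono /= scalerDl mm' addrA.
Qed.

Lemma nc_sum_collect s : nc_sum (nc_collect s) = nc_sum s.
Proof. by elim: s => [|m s ih] //=; rewrite nc_sum_insert ih. Qed.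

Lemma nc_sum_null s : nc_null s -> nc_sum s = 0.
Proof.
by elim: s => [|m s ih] //= [m0 /ih ->]; rewrite /nc_mono m0 scale0r addr0.
Qed.

Lemma nc_eq (e1 e2 : ncexpr K) :
  nc_null (nc_collect (nc_norm (NCAdd e1 (NCOpp e2)))) -> nc_eval e1 = nc_eval e2.
Proof.
move=> /nc_sum_null; rewrite nc_sum_collect nc_sum_norm /= => /eqP.
by rewrite subr_eq0 => /eqP.
Qed.

End NCAlg.

Ltac nc_index x env :=
  lazymatch env with
  | x :: _ => constr:(O)
  | _ :: ?env' => let n := nc_index x env' in constr:(S n)
  end.

Ltac nc_mem x env :=
  lazymatch env with
  | x :: _ => constr:(true)
  | _ :: ?env' => nc_mem x env'
  | _ => constr:(false)
  end.

Ltac nc_vars env e :=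
  lazymatch e with
  | @GRing.add _ ?x ?y => let env := nc_vars env x in nc_vars env y
  | @GRing.opp _ ?x => nc_vars env x
  | @GRing.mul _ ?x ?y => let env := nc_vars env x in nc_vars env y
  | @GRing.scale _ _ _ ?x => nc_vars env x
  | @GRing.zero _ => env
  | @GRing.one _ => env
  | _ => lazymatch nc_mem e env with true => env | false => constr:(e :: env) end
  end.

Ltac nc_reify K env e :=
  lazymatch e with
  | @GRing.add _ ?x ?y =>
      let x := nc_reify K env x in let y := nc_reify K env y in
      constr:(@NCAdd K x y)
  | @GRing.opp _ ?x => let x := nc_reify K env x in constr:(@NCOpp K x)
  | @GRing.mul _ ?x ?y =>
      let x := nc_reify K env x in let y := nc_reify K env y in
      constr:(@NCMul K x y)
  | @GRing.scale _ _ ?k ?x =>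
      let x := nc_reify K env x in constr:(@NCScale K k x)
  | @GRing.zero _ => constr:(@NCZero K)
  | @GRing.one _ => constr:(@NCOne K)
  | _ => let n := nc_index e env in constr:(@NCVar K n)
  end.

Ltac ncalg_on K V :=
  lazymatch goal with
  | |- @eq _ ?x ?y =>
    let env := nc_vars (@nil V) x in
    let env := nc_vars env y in
    let e1 := nc_reify K env x in
    let e2 := nc_reify K env y in
    refine (@nc_eq K V env e1 e2 _);
    cbv [nc_null nc_collect nc_norm nc_insert nc_mul nc_mul1 nc_scale nc_weq
         cat fst snd eqn andb]
  end.

(* Leaves one equation between scalars for each word occurring in the difference. *)
Ltac ncalg :=
  match goal with
  | C : cstarAlgType ?R |- _ =>
      ncalg_on (R[i] : comNzRingType) (C : algType R[i]); repeat split
  end.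

(** * Real-valued norm and adjoint *)

Lemma realC_neq0 (R : realType) (r : R) : r != 0 -> r%:C != 0 :> R[i].
Proof. by apply: contra => /eqP/complexI ->. Qed.

Section NormR.
Variables (R : realType) (V : normedModType R[i]).
Implicit Types (x y z : V) (k : R[i]) (r s t : R).

Lemma normRE x : `|x| = (normR x)%:C.
Proof. by rewrite /normR RRe_real // ger0_real. Qed.

Lemma normR_ge0 x : 0 <= normR x.
Proof. by rewrite -ler0c -normRE. Qed.

Lemma ler_normR x r : (`|x| <= r%:C) = (normR x <= r).
Proof. by rewrite normRE lecR. Qed.

Lemma ltr_normR x r : (`|x| < r%:C) = (normR x < r).
Proof. by rewrite normRE ltcR. Qed.

Lemma normR0 : normR (0 : V) = 0.
Proof. by rewrite /normR normr0. Qed.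

Lemma normRN x : normR (- x) = normR x.
Proof. by rewrite /normR normrN. Qed.

Lemma normRD x y : normR (x + y) <= normR x + normR y.
Proof. by rewrite -lecR rmorphD /= -!normRE ler_normD. Qed.

Lemma normRB x y : normR (x - y) <= normR x + normR y.
Proof. by rewrite -(normRN y) normRD. Qed.

Lemma normR_distrC x y : normR (x - y) = normR (y - x).
Proof. by rewrite -normRN opprB. Qed.

Lemma normRZ k x : normR (k *: x) = complex.Re `|k| * normR x.
Proof.
by apply: complexI; rewrite -normRE normrZ normRE rmorphM /= RRe_real // ger0_real.
Qed.

Lemma normc_real r : `|r%:C| = `|r|%:C :> R[i].
Proof. by rewrite normc_def /= expr0n /= addr0 sqrtr_sqr. Qed.

Lemma normRZr r x : normR (r%:C *: x) = `|r| * normR x.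
Proof. by rewrite normRZ normc_real. Qed.

Lemma normR_eq0 x : normR x = 0 -> x = 0.
Proof. by move=> x0; apply/normr0_eq0; rewrite normRE x0. Qed.

End NormR.

Section Basics.
Variables (R : realType) (C : cstarAlgType R).
Implicit Types (x y z : C) (k : R[i]) (r s t : R).

Lemma starDE x y : star (x + y) = star x + star y. Proof. exact: starD. Qed.

Lemma star0 : star (0 : C) = 0.
Proof. by apply: (@addrI _ (star 0)); rewrite -starDE !addr0. Qed.

Lemma starN x : star (- x) = - star x.
Proof. by apply/eqP; rewrite -addr_eq0 -starDE addNr star0. Qed.

Lemma starB x y : star (x - y) = star x - star y.
Proof. by rewrite starDE starN. Qed.

Lemma star_mul x y : star (x * y) = star y * star x.
Proof. exact: starM. Qed.

Lemma star1 : star (1 : C) = 1.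
Proof. by rewrite -[LHS]mulr1 -{2}[1]starK -star_mul mulr1 starK. Qed.

Lemma conj_realC r : Num.conj (r%:C) = r%:C :> R[i].
Proof. by apply: CrealP; rewrite complex_real. Qed.

Lemma starZr r x : star (r%:C *: x) = r%:C *: star x.
Proof. by rewrite starZ conj_realC. Qed.

Lemma normRM x y : normR (x * y) <= normR x * normR y.
Proof. by rewrite -lecR rmorphM /= -!normRE; exact: cstar_normM. Qed.

Lemma normR_starM x : normR (star x * x) = normR x ^+ 2.
Proof. by apply: complexI; rewrite rmorphXn /= -!normRE; exact: cstar_norm. Qed.

(** The C*-identity and submultiplicativity give |y|^2 <= |star y| |y|, to be used for [x] and for
    [star x]. *)
Lemma normR_star x : normR (star x) = normR x.
Proof.
have le_star y : normR y <= normR (star y).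
  have := normRM (star y) y; rewrite normR_starM expr2.
  have [->|y0] := eqVneq (normR y) 0; first by rewrite normR_ge0.
  by rewrite ler_pM2r // lt_def y0 normR_ge0.
by apply/eqP; rewrite eq_le le_star -{2}(starK x) le_star.
Qed.

Lemma normR_sqr x : star x = x -> normR (x * x) = normR x ^+ 2.
Proof. by move=> xsa; rewrite -{1}xsa normR_starM. Qed.

Lemma normR1 : normR (1 : C) = 1.
Proof.
have /eqP := normR_starM 1; rewrite mulr1 star1 expr2 -{1}[normR (1 : C)]mulr1.
rewrite -subr_eq0 -mulrBr mulf_eq0 subr_eq0 => /orP[/eqP/normR_eq0/eqP|/eqP//].
by rewrite oner_eq0.
Qed.

Lemma normRA r : normR (r%:C *: 1 : C) = `|r|.
Proof. by rewrite normRZr normR1 mulr1. Qed.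

End Basics.

(** * Closed subalgebras *)

Section Closed.
Variables (R : realType) (V : completeNormedModType R[i]).
Implicit Types (S : set V) (x y : V).

Lemma posc_real (e : R[i]) : 0 < e -> exists2 d : R, 0 < d & e = d%:C.
Proof.
move=> e0; have /complex_realP[d de] : e \is Num.real by rewrite gtr0_real.
by exists d => //; rewrite -ltcR -de.
Qed.

Lemma closed_approx S x : closed S ->
  (forall e : R, 0 < e -> exists2 y, S y & normR (x - y) < e) -> S x.
Proof.
move=> Scl Sx; apply: Scl => B /nbhs_normP[e /= /posc_real[d d0 ->] xeB].
have [y Sy xy] := Sx d d0; exists y; split => //; apply: xeB.
by rewrite /= ltr_normR.
Qed.

Lemma approx_closed S :
  (forall x, (forall e : R, 0 < e -> exists2 y, S y & normR (x - y) < e) -> S x) ->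
  closed S.
Proof.
move=> Sapp x Sx; apply: Sapp => e e0.
have [|y [Sy]] := Sx (ball x e%:C); first by apply: nbhsx_ballx; rewrite ltcR.
by rewrite -ball_normE /= ltr_normR; exists y.
Qed.

Lemma complete_approx S (u : nat -> V) (r : nat -> R) :
  closed S -> (forall n, S (u n)) ->
  (forall n m, (n <= m)%N -> normR (u m - u n) <= r n) ->
  r @ \oo --> 0 ->
  exists2 l, S l & forall n, normR (l - u n) <= r n.
Proof.
move=> Scl Su ur r0.
have small_r (d : R) : 0 < d -> exists N, forall n, (N <= n)%N -> r n < d.
  move=> d0; have [N _ rN] : \forall n \near \oo, `|r n| < d.
    by have /cvgr0_norm_lt := r0; apply.
  by exists N => n Nn; rewrite (le_lt_trans (ler_norm _)) // rN.
have : cauchy (u @ \oo).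
  apply: cauchy_exP => e /posc_real[d d0 ->].
  have [N rN] := small_r d d0; exists (u N), N => // n /= Nn.
  by rewrite -ball_normE /= ltr_normR normR_distrC (le_lt_trans (ur N n Nn)) // rN.
move=> /cauchy_cvgP/cvg_ex[l ul].
have near_l (d : R) : 0 < d -> exists N, forall n, (N <= n)%N -> normR (l - u n) < d.
  move=> d0; have /cvgrPdist_lt/(_ d%:C) := ul.
  rewrite ltcR => /(_ d0)[N _ lN]; exists N => n Nn.
  by have := lN n Nn; rewrite ltr_normR.
exists l.
  apply: (closed_approx Scl) => e /near_l[N lN]; exists (u N) => //; exact: lN.
move=> n; apply/ler_addgt0Pr => e /near_l[N lN].
rewrite -(subrKA (u (maxn n N))) (le_trans (normRD _ _)) // addrC lerD //.
  by rewrite ur // leq_maxl.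
by rewrite ltW // lN // leq_maxr.
Qed.

End Closed.

Section Subalgebra.
Variables (R : realType) (C : cstarAlgType R).
Implicit Types (x y z : C) (k : R[i]) (S : set C).

Lemma subalg1 S : unital_operator_algebra S -> S 1.
Proof. by move=> [_ [+ _ _]]; rewrite in_setE. Qed.

Lemma subalg_lin S k x y : unital_operator_algebra S -> S x -> S y -> S (k *: x + y).
Proof.
by move=> [_ [_ + _]] => /(_ k x y); rewrite !in_setE /= => Slin Sx Sy; apply: Slin.
Qed.

Lemma subalgM S x y : unital_operator_algebra S -> S x -> S y -> S (x * y).
Proof.
by move=> [_ [_ _]] => /(_ x y); rewrite !in_setE /= => SM Sx Sy; apply: SM.
Qed.

Lemma subalg0 S : unital_operator_algebra S -> S 0.
Proof.
move=> hS; rewrite -(addNr (1 : C)) -scaleN1r.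
by apply: subalg_lin => //; apply: subalg1.
Qed.

Lemma subalgZ S k x : unital_operator_algebra S -> S x -> S (k *: x).
Proof.
by move=> hS Sx; rewrite -[_ *: _]addr0; apply: subalg_lin => //; apply: subalg0.
Qed.

Lemma subalgD S x y : unital_operator_algebra S -> S x -> S y -> S (x + y).
Proof. by move=> hS Sx Sy; rewrite -[x]scale1r; apply: subalg_lin. Qed.

Lemma subalgN S x : unital_operator_algebra S -> S x -> S (- x).
Proof. by move=> hS Sx; rewrite -scaleN1r; apply: subalgZ. Qed.

Lemma subalgB S x y : unital_operator_algebra S -> S x -> S y -> S (x - y).
Proof. by move=> hS Sx Sy; apply: subalgD => //; apply: subalgN. Qed.

Lemma subalgC S k : unital_operator_algebra S -> S (k *: 1).
Proof. by move=> hS; apply: subalgZ => //; apply: subalg1. Qed.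

(** Running an iteration inside [S] intersected with a commutant makes its limit commute with [y];
    this replaces the usual fact about functional calculus. *)
Definition commutant y : set C := [set x | x * y = y * x].

Lemma commutant_subalg y : unital_operator_algebra (commutant y).
Proof.
split.
  apply: approx_closed => x xapp; apply/eqP; rewrite -subr_eq0; apply/eqP.
  apply: normR_eq0; apply/eqP; rewrite eq_le normR_ge0 andbT.
  apply/ler_addgt0Pr => e e0; rewrite add0r.
  pose M := 2 * normR y + 1.
  have M0 : 0 < M by rewrite ltr_wpDl // mulr_ge0 // normR_ge0.
  have [x' x'y xx'] := xapp (e / M) (divr_gt0 e0 M0).
  have -> : x * y - y * x = (x - x') * y - y * (x - x').
    rewrite mulrBl mulrBr (x'y : x' * y = y * x') opprB addrA addrNK.
    by [].
  rewrite (le_trans (normRB _ _)) // (le_trans (lerD (normRM _ _) (normRM _ _))) //.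
  rewrite [normR y * _]mulrC -mulrDr -mulr2n -mulr_natl.
  rewrite -[leRHS](divfK (lt0r_neq0 M0)).
  rewrite ler_pM ?normR_ge0 ?mulr_ge0 ?normR_ge0 // ?ltW //.
  by rewrite ltrDl.
split; rewrite ?in_setE /commutant /=.
- by rewrite mulr1 mul1r.
- move=> k x z; rewrite !in_setE /= => xy zy.
  by rewrite mulrDl mulrDr -scalerAl -scalerAr xy zy.
- move=> x z; rewrite !in_setE /= => xy zy.
  by rewrite -mulrA zy mulrA xy mulrA.
Qed.

Lemma subalgT : unital_operator_algebra (setT : set C).
Proof. by split; [exact: closedT | split => [|k x y|x y]; rewrite !in_setE]. Qed.

Lemma subalgI S T : unital_operator_algebra S -> unital_operator_algebra T ->
  unital_operator_algebra (S `&` T).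
Proof.
move=> hS hT; split; first by apply: closedI; [case: hS | case: hT].
split.
- by rewrite in_setE; split; apply: subalg1.
- move=> k x y; rewrite !in_setE => -[Sx Tx] [Sy Ty].
  by split; apply: subalg_lin.
- move=> x y; rewrite !in_setE => -[Sx Tx] [Sy Ty].
  by split; apply: subalgM.
Qed.

End Subalgebra.

(** * Inverses and square roots *)

Section Iterations.
Variables (R : realType) (V : completeNormedModType R[i]).

(** Method of majorants: the increments of [u] are dominated by those of a bounded monotone real
    sequence. No rate of convergence is required, which matters for the square root of [1 - a] when
    |a| = 1, where convergence is not geometric. *)
Lemma majorant_limit (S : set V) (u : nat -> V) (beta : nat -> R) (B : R) :
  closed S -> (forall n, S (u n)) ->
  (forall n, normR (u n.+1 - u n) <= beta n.+1 - beta n) ->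
  (forall n, beta n <= B) ->
  exists l, [/\ S l, normR (l - u 0) <= B - beta 0 &
    forall e, 0 < e -> exists N, forall n, (N <= n)%N -> normR (l - u n) < e].
Proof.
move=> Scl Su ub bB.
have bnd : {homo beta : n m / (n <= m)%N >-> n <= m}.
  apply/nondecreasing_seqP => n.
  by rewrite -subr_ge0 (le_trans (normR_ge0 _) (ub n)).
have bub : has_ubound (range beta) by exists B => _ [n _ <-]; apply: bB.
have bcvg := nondecreasing_is_cvgn bnd bub.
pose b := limn beta.
have beta_b n : beta n <= b by apply: nondecreasing_cvgn_le.
have b_B : b <= B by apply: limr_le => //; near=> n; apply: bB.
have rcvg : (fun n => b - beta n) @ \oo --> 0.
  by rewrite -(subrr b); apply: cvgB => //; apply: cvg_cst.
have um n m : (n <= m)%N -> normR (u m - u n) <= beta m - beta n.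
  elim: m => [|m ih]; first by rewrite leqn0 => /eqP ->; rewrite !subrr normR0.
  rewrite leq_eqVlt => /orP[/eqP ->|]; first by rewrite !subrr normR0.
  rewrite ltnS => /ih nm; rewrite -(subrKA (u m)) (le_trans (normRD _ _)) //.
  by rewrite -[leRHS](subrKA (beta m)) lerD.
have [||l Sl lu] := @complete_approx R V S u (fun n => b - beta n) Scl Su.
- by move=> n m nm; rewrite (le_trans (um n m nm)) // lerD2r.
- exact: rcvg.
exists l; split => //; first by rewrite (le_trans (lu 0%N)) // lerD2r.
move=> e e0; have [N _ rN] : \forall n \near \oo, `|b - beta n| < e.
  by have /cvgr0_norm_lt := rcvg; apply.
exists N => n Nn; rewrite (le_lt_trans (lu n)) //.
by rewrite (le_lt_trans (ler_norm _)) // rN.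
Unshelve. all: by end_near. Qed.

Lemma normR_small_eq0 (x : V) (M : R) :
  (forall e, 0 < e -> e < 1 -> normR x <= M * e) -> x = 0.
Proof.
move=> xM; apply: normR_eq0; apply/eqP; rewrite eq_le normR_ge0 andbT leNgt.
apply/negP => x0.
(* [K] exceeds [M], so that [M * e] stays below [normR x], and exceeds [normR x], so that
   [e < 1]. *)
pose K := `|M| + normR x + 1.
have K0 : 0 < K by rewrite ltr_wpDl // addr_ge0 // normR_ge0.
have e0 : 0 < normR x / (2 * K) by rewrite divr_gt0 // mulr_gt0.
have e1 : normR x / (2 * K) < 1.
  rewrite ltr_pdivrMr ?mulr_gt0 // mul1r /K.
  have := normr_ge0 M; lra.
have := xM _ e0 e1; apply/negP; rewrite -ltNge.
apply: (@le_lt_trans _ _ (K * (normR x / (2 * K)))).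
  rewrite ler_wpM2r ?(ltW e0) // /K.
  by have := ler_norm M; have := normR_ge0 x; lra.
have -> : K * (normR x / (2 * K)) = normR x / 2 by field; rewrite gt_eqF.
by rewrite ltr_pdivrMr //; lra.
Qed.

End Iterations.

Section InverseSqrt.
Variables (R : realType) (C : cstarAlgType R).
Implicit Types (x y z a b : C) (S : set C).

(** [u n] is a partial sum of the geometric series of [x], and [beta n] that of [normR x]. The limit
    commutes with [x], so a right inverse is also a left inverse. *)
Lemma neumann S x : unital_operator_algebra S -> S x -> normR x < 1 ->
  exists y, [/\ S y, (1 - x) * y = 1, y * (1 - x) = 1 &
    normR y <= (1 - normR x)^-1].
Proof.
move=> hS Sx x1.
have x0 := normR_ge0 x.
pose u := fix u n : C := if n is n'.+1 then 1 + x * u n' else 0.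
pose beta := fix beta n : R := if n is n'.+1 then 1 + normR x * beta n' else 0.
have hT := subalgI hS (commutant_subalg x).
have x1_gt0 : 0 < 1 - normR x by lra.
have uS n : (S `&` commutant x) (u n).
  elim: n => [|n ih]; first exact: subalg0.
  apply: subalgD => //; first exact: subalg1.
  by apply: subalgM => //; split.
have ub n : normR (u n.+1 - u n) <= beta n.+1 - beta n.
  elim: n => [|n ih]; first by rewrite /= !mulr0 !addr0 !subr0 normR1.
  have -> : u n.+2 - u n.+1 = x * (u n.+1 - u n) by rewrite /=; ncalg; ring.
  rewrite (le_trans (normRM _ _)) //.
  have -> : beta n.+2 - beta n.+1 = normR x * (beta n.+1 - beta n).
    by rewrite /=; ring.
  by rewrite ler_wpM2l.
have betaB n : beta n <= (1 - normR x)^-1.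
  elim: n => [|n ih] /=; first by rewrite invr_ge0 ltW.
  have -> : (1 - normR x)^-1 = 1 + normR x * (1 - normR x)^-1.
    by field; rewrite gt_eqF.
  by rewrite lerD2l ler_wpM2l.
have [y [[Sy xy] yB yu]] := majorant_limit (proj1 hT) uS ub betaB.
have y1 : y - (1 + x * y) = 0.
  apply: (@normR_small_eq0 _ _ _ 2) => e e0 _.
  have [N yN] := yu e e0.
  have -> : y - (1 + x * y) = (y - u N.+1) + x * (u N - y) by rewrite /=; ncalg; ring.
  rewrite (le_trans (normRD _ _)) // mulr_natl mulr2n lerD //.
    by rewrite ltW // yN.
  rewrite (le_trans (normRM _ _)) // -[leRHS]mul1r ler_pM ?normR_ge0 //.
    exact: ltW.
  by rewrite normR_distrC ltW // yN.
have y2 : (1 - x) * y = 1.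
  by rewrite mulrBl mul1r; apply/eqP; rewrite subr_eq addrC -subr_eq0 addrC y1 ?eqxx // addrC.
exists y; split => //; last by move: yB; rewrite /= !subr0.
by move: y2; rewrite mulrBl mulrBr mul1r mulr1 (xy : y * x = x * y).
Qed.

Lemma half_sum x : (2^-1)%:C *: x + (2^-1)%:C *: x = x.
Proof.
by rewrite -scalerDl -rmorphD /= -{2}[x]scale1r; congr (_ *: _); congr (_%:C); lra.
Qed.

(** A fixed point of b = (a + b^2) / 2 satisfies (1 - b)^2 = 1 - a. The majorant is the same
    iteration for the number |a|; its smaller fixed point is 1 - sqrt (1 - |a|). This bound is below
    1 when |a| < 1, which makes [1 - b] invertible. *)
Lemma sqrt_one_sub S a : unital_operator_algebra S -> S a -> star a = a ->
  normR a <= 1 ->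
  exists b, [/\ S b, star b = b, (1 - b) * (1 - b) = 1 - a &
    normR b <= 1 - Num.sqrt (1 - normR a)].
Proof.
move=> hS Sa asa a1.
set al := normR a; set B := 1 - Num.sqrt (1 - al).
have al0 : 0 <= al := normR_ge0 a.
have sq : (Num.sqrt (1 - al)) ^+ 2 = 1 - al by rewrite sqr_sqrtr // subr_ge0.
have sq0 : 0 <= Num.sqrt (1 - al) := sqrtr_ge0 _.
have B1 : B <= 1 by rewrite /B; lra.
have BE : B = (al + B * B) / 2 by move: sq; rewrite /B expr2 => sq; lra.
have B0 : 0 <= B.
  by rewrite BE divr_ge0 // addr_ge0 // -expr2 sqr_ge0.
pose h : R[i] := (2^-1)%:C.
pose u := fix u n : C := if n is n'.+1 then h *: (a + u n' * u n') else 0.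
pose beta := fix beta n : R := if n is n'.+1 then (al + beta n' * beta n') / 2 else 0.
have betaB n : 0 <= beta n /\ beta n <= B.
  elim: n => [|n [ih0 ihB]] /=; first by [].
  split; first by rewrite divr_ge0 // addr_ge0 // mulr_ge0.
  by rewrite BE ler_wpM2r ?invr_ge0 // lerD2l ler_pM.
have normh x : normR (h *: x) = normR x / 2.
  by rewrite normRZr ger0_norm ?invr_ge0 // mulrC.
have ule n : normR (u n) <= beta n.
  elim: n => [|n ih] /=; first by rewrite normR0.
  rewrite normh ler_wpM2r ?invr_ge0 // (le_trans (normRD _ _)) // lerD2l.
  by rewrite (le_trans (normRM _ _)) // ler_pM ?normR_ge0.
have ub n : normR (u n.+1 - u n) <= beta n.+1 - beta n.
  elim: n => [|n ih].
    by rewrite /= !mulr0 !addr0 !subr0 normh.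
  (* v^2 - w^2 = v (v - w) + (v - w) w holds without commutation, and [beta] satisfies the same
     formula. *)
  have -> : u n.+2 - u n.+1 =
      h *: (u n.+1 * (u n.+1 - u n) + (u n.+1 - u n) * u n).
    have -> : u n.+2 - u n.+1 =
      h *: (a + u n.+1 * u n.+1) - h *: (a + u n * u n) by [].
    move: (u n.+1) (u n) => v w.
    by ncalg; ring.
  have -> : beta n.+2 - beta n.+1 =
      (beta n.+1 * (beta n.+1 - beta n) + (beta n.+1 - beta n) * beta n) / 2.
    have -> : beta n.+2 - beta n.+1 =
      (al + beta n.+1 * beta n.+1) / 2 - (al + beta n * beta n) / 2 by [].
    by move: (beta n.+1) (beta n) => v w; field.
  rewrite normh ler_wpM2r ?invr_ge0 // (le_trans (normRD _ _)) // lerD //.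
    by rewrite (le_trans (normRM _ _)) // ler_pM ?normR_ge0.
  by rewrite (le_trans (normRM _ _)) // ler_pM ?normR_ge0.
have uS n : (S `&` [set x | star x = x]) (u n).
  elim: n => [|n [ih1 ih2]].
    by split; [exact: subalg0 | exact: star0].
  split.
    by apply: subalgZ => //; apply: subalgD => //; apply: subalgM.
  by rewrite /= starZr starDE star_mul ih2 asa.
have Tcl : closed (S `&` [set x | star x = x]).
  apply: closedI; first by case: hS.
  apply: approx_closed => x xapp; apply/eqP; rewrite -subr_eq0; apply/eqP.
  apply: (@normR_small_eq0 _ _ _ 2) => e e0 _.
  have [y ysa xy] := xapp e e0.
  have -> : star x - x = star (x - y) - (x - y) by rewrite starB ysa; ncalg; ring.
  rewrite (le_trans (normRB _ _)) // normR_star mulr_natl mulr2n.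
  by rewrite lerD // ltW.
have [b [[Sb bsa] bB bu]] := majorant_limit Tcl uS ub (fun n => proj2 (betaB n)).
have {}bB : normR b <= B by move: bB; rewrite /= !subr0.
exists b; split => //.
have b1 : b - h *: (a + b * b) = 0.
  apply: (@normR_small_eq0 _ _ _ 2) => e e0 _.
  have [N bN] := bu e e0.
  have -> : b - h *: (a + b * b) =
      (b - u N.+1) + h *: (u N * (u N - b) + (u N - b) * b).
    by rewrite /=; ncalg; ring.
  rewrite (le_trans (normRD _ _)) // mulr_natl mulr2n lerD //.
    by rewrite ltW // bN.
  rewrite normh ler_pdivrMr // (le_trans (normRD _ _)) //.
  rewrite mulr_natr mulr2n lerD // (le_trans (normRM _ _)) //.
    rewrite -[e]mul1r ler_pM ?normR_ge0 //.
      by rewrite (le_trans (ule N)) // (le_trans (proj2 (betaB N))).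
    by rewrite normR_distrC ltW // bN.
  rewrite -[e]mulr1 ler_pM ?normR_ge0 //.
    by rewrite normR_distrC ltW // bN.
  exact: le_trans bB B1.
have -> : (1 - b) * (1 - b) = 1 - b - b + b * b by ncalg; ring.
have -> : 1 - b - b = 1 - h *: (a + b * b) - h *: (a + b * b).
  by move/eqP: b1; rewrite subr_eq0 => /eqP <-.
by rewrite -[X in X + _]addrA -opprD half_sum opprD addrA subrK.
Qed.

End InverseSqrt.

(** * The positive cone *)

Section Order.
Variables (R : realType) (C : cstarAlgType R).
Implicit Types (x y z h k : C) (S : set C) (r t : R).

(* Membership in the cone expressed by the norm alone, which makes closure under
   sums obvious; [cnonneg_spos] identifies it with [cnonneg]. *)
Definition spos x : Prop :=
  star x = x /\ exists2 t, 0 <= t & normR (t%:C *: 1 - x) <= t.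

Lemma spos_add x y : spos x -> spos y -> spos (x + y).
Proof.
move=> [xsa [t t0 xt]] [ysa [s s0 ys]]; split; first by rewrite starDE xsa ysa.
exists (t + s); first exact: addr_ge0.
have -> : (t + s)%:C *: 1 - (x + y) = (t%:C *: 1 - x) + (s%:C *: 1 - y).
  by rewrite rmorphD /=; ncalg; ring.
by rewrite (le_trans (normRD _ _)) // lerD.
Qed.

Lemma spos_scale r x : 0 <= r -> spos x -> spos (r%:C *: x).
Proof.
move=> r0 [xsa [t t0 xt]]; split; first by rewrite starZr xsa.
exists (r * t); first exact: mulr_ge0.
have -> : (r * t)%:C *: 1 - r%:C *: x = r%:C *: (t%:C *: 1 - x).
  by rewrite rmorphM /=; ncalg; ring.
by rewrite normRZr ger0_norm // ler_wpM2l.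
Qed.

Lemma spos_subr r x : star x = x -> normR x <= r -> spos (r%:C *: 1 - x).
Proof.
move=> xsa xr; split; first by rewrite starB starZr star1 xsa.
exists r; first by rewrite (le_trans (normR_ge0 x)).
by rewrite opprB addrCA subrr addr0.
Qed.

Lemma spos_real r : 0 <= r -> spos (r%:C *: 1 : C).
Proof.
by move=> r0; rewrite -[_ *: _]subr0; apply: spos_subr; rewrite ?star0 ?normR0.
Qed.

(* [h + 'i k] is unitary. *)
Lemma commuting_unit_circle h k :
  star h = h -> star k = k -> h * k = k * h -> h * h + k * k = 1 ->
  normR h <= 1 /\ normR (h * h - k * k) <= 1.
Proof.
move=> hsa ksa hk hk1.
pose j : C := 'i%C *: k.
have jsa : star j = - j.
  rewrite /j starZ ksa -scaleNr; congr (_ *: _).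
  by rewrite complexiE conjCi.
have jj : j * j = - (k * k).
  by rewrite /j -scalerAl -scalerAr scalerA -expr2 sqr_i scaleN1r.
have hj : h * j = j * h by rewrite /j -scalerAl -scalerAr hk.
have su : star (h + j) = h - j by rewrite starDE hsa jsa.
have u1 : normR (h + j) = 1.
  have : normR (h + j) ^+ 2 = 1 ^+ 2.
    rewrite -normR_starM su.
    have -> : (h - j) * (h + j) = h * h - j * j + (h * j - j * h) by ncalg; ring.
    by rewrite hj subrr addr0 jj opprK hk1 normR1 expr1n.
  by move=> /eqP; rewrite eqrXn2 ?normR_ge0 // => /eqP.
have us1 : normR (h - j) = 1 by rewrite -su normR_star.
have half (x y : C) : normR x <= 1 -> normR y <= 1 ->
    normR ((2^-1)%:C *: (x + y)) <= 1.
  move=> x1 y1; rewrite normRZr ger0_norm ?invr_ge0 // mulrC ler_pdivrMr //.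
  by rewrite (le_trans (normRD _ _)) // mul1r -[2]/(1 + 1) lerD.
split.
  have -> : h = (2^-1)%:C *: ((h + j) + (h - j)).
    by rewrite addrACA subrr addr0 scalerDr half_sum.
  by rewrite half ?u1 ?us1.
have -> : h * h - k * k =
    (2^-1)%:C *: ((h + j) * (h + j) + (h - j) * (h - j)).
  have -> : (h + j) * (h + j) + (h - j) * (h - j) =
      (h * h + j * j) + (h * h + j * j) by ncalg; ring.
  by rewrite jj scalerDr half_sum.
by rewrite half // (le_trans (normRM _ _)) ?u1 ?us1 ?mulr1.
Qed.

(** Doubling of the angle: with k the root of 1 - h^2, 1 - 2 h^2 = k^2 - h^2 is minus the real part
    of the square of the unitary h + 'i k. *)
Lemma contraction_double_sqr h : star h = h -> normR h <= 1 ->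
  normR (1 - 2%:C *: (h * h)) <= 1.
Proof.
move=> hsa h1.
have [|||b [bh bsa bb _]] := @sqrt_one_sub R C _ (h * h) (commutant_subalg h).
- by rewrite /commutant /= mulrA.
- by rewrite star_mul hsa.
- by rewrite normR_sqr // expr_le1 // normR_ge0.
have bsa1 : star (1 - b) = 1 - b by rewrite starB star1 bsa.
have hb : h * (1 - b) = (1 - b) * h.
  by rewrite mulrBr mulrBl mulr1 mul1r (bh : b * h = h * b).
have hb1 : h * h + (1 - b) * (1 - b) = 1 by rewrite bb addrCA subrr addr0.
have [_] := commuting_unit_circle hsa bsa1 hb hb1.
rewrite bb -normRN; congr (normR _ <= _).
rewrite -[2]/(1 + 1) rmorphD rmorph1; ncalg; ring.
Qed.

Lemma spos_sqr h : star h = h -> spos (h * h).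
Proof.
move=> hsa; split; first by rewrite star_mul hsa.
(* N^2 / 2 - h^2 = (N^2 / 2) (1 - 2 (h / N)^2), and h / N is a contraction; this dictates the radius
   N^2 / 2. *)
pose N := normR h + 1.
have N0 : 0 < N by rewrite ltr_wpDl // normR_ge0.
exists (N ^+ 2 / 2); first by rewrite divr_ge0 // sqr_ge0.
have hN : normR (1 - 2%:C *: ((N^-1)%:C *: h * ((N^-1)%:C *: h))) <= 1.
  apply: contraction_double_sqr; first by rewrite starZr hsa.
  rewrite normRZr ger0_norm ?invr_ge0 ?ltW // mulrC ltr_pdivrMr // mul1r.
  by rewrite ltrDl.
have -> : (N ^+ 2 / 2)%:C *: 1 - h * h = (N ^+ 2 / 2)%:C *:
    (1 - 2%:C *: ((N^-1)%:C *: h * ((N^-1)%:C *: h))).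
  rewrite rmorphM rmorphXn !fmorphV /=.
  by ncalg; field; rewrite ?realC_neq0 ?gt_eqF.
rewrite normRZr ger0_norm ?divr_ge0 ?sqr_ge0 // -[leRHS]mulr1 ler_wpM2l //.
by rewrite divr_ge0 // sqr_ge0.
Qed.

(** The norm condition says x = t (1 - a) with |a| <= 1, so sqrt t (1 - b) is a root, with b given
    by [sqrt_one_sub]. The radius is first enlarged by 1 to make it nonzero. *)
Lemma spos_sqrt S x : unital_operator_algebra S -> S x -> spos x ->
  exists h, [/\ S h, star h = h, spos h & h * h = x].
Proof.
move=> hS Sx [xsa [t' t'0 xt']].
pose t := t' + 1.
have t0 : 0 < t by rewrite /t ltr_wpDl.
have xt : normR (t%:C *: 1 - x) <= t.
  have -> : t%:C *: 1 - x = 1 + (t'%:C *: 1 - x).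
    by rewrite /t rmorphD rmorph1; ncalg; ring.
  by rewrite (le_trans (normRD _ _)) // normR1 /t addrC lerD2r.
pose a : C := (t^-1)%:C *: (t%:C *: 1 - x).
have [||||b [Sb bsa bb b1]] := @sqrt_one_sub R C S a.
- exact: hS.
- by apply: subalgZ => //; apply: subalgB => //; apply: subalgC.
- by rewrite starZr starB starZr star1 xsa.
- by rewrite normRZr ger0_norm ?invr_ge0 ?(ltW t0) // ler_pdivrMl // mulr1.
have a1 : 1 - a = (t^-1)%:C *: x.
  by rewrite /a fmorphV; ncalg; field; rewrite ?realC_neq0 ?gt_eqF.
have b1' : normR b <= 1.
  by rewrite (le_trans b1) // gerDl oppr_le0 sqrtr_ge0.
have sp1b : spos (1 - b).
  by rewrite -[1](scale1r (1 : C)); apply: (@spos_subr 1).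
exists ((Num.sqrt t)%:C *: (1 - b)); split.
- by apply: subalgZ => //; apply: subalgB => //; apply: subalg1.
- by rewrite starZr starB star1 bsa.
- by apply: spos_scale => //; apply: sqrtr_ge0.
rewrite -scalerAl -scalerAr scalerA bb a1 -rmorphM -expr2 sqr_sqrtr ?(ltW t0) //.
by rewrite scalerA -rmorphM divff ?gt_eqF // scale1r.
Qed.

(** Commuting roots h of x and k of 1 - x satisfy h^2 + k^2 = 1, so h is the real part of a
    unitary. *)
Lemma spos_le1 x : spos x -> spos (1 - x) -> normR x <= 1.
Proof.
move=> xpos x1pos.
have [h [_ hsa _ hx]] := spos_sqrt (subalgT C) I xpos.
have [|k [kh ksa _ kx]] := spos_sqrt (commutant_subalg h) _ x1pos.
  by rewrite /commutant /= mulrBl mulrBr mul1r mulr1 -hx mulrA.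
have hk : h * k = k * h by rewrite (kh : k * h = h * k).
have hk1 : h * h + k * k = 1 by rewrite hx kx addrCA subrr addr0.
have [h1 _] := commuting_unit_circle hsa ksa hk hk1.
by rewrite -hx normR_sqr // expr_le1 // normR_ge0.
Qed.

Lemma spos_norm r x : 0 <= r -> spos x -> spos (r%:C *: 1 - x) -> normR x <= r.
Proof.
move=> r0 xpos xr; apply/ler_addgt0Pr => e e0.
have re0 : 0 < r + e by rewrite ltr_wpDl.
have : normR (((r + e)^-1)%:C *: x) <= 1.
  apply: spos_le1; first by apply: spos_scale => //; rewrite invr_ge0 ltW.
  have -> : 1 - ((r + e)^-1)%:C *: x =
      ((r + e)^-1)%:C *: ((r%:C *: 1 - x) + e%:C *: 1).
    rewrite addrAC -scalerDl -rmorphD scalerBr scalerA -rmorphM mulVf ?gt_eqF //.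
    by rewrite scale1r.
  apply: spos_scale; first by rewrite invr_ge0 ltW.
  by apply: spos_add => //; apply: spos_real; apply: ltW.
by rewrite normRZr ger0_norm ?invr_ge0 ?(ltW re0) // ler_pdivrMl // mulr1.
Qed.

(* The roots [np], [nq] of [p ^ 3], [q ^ 3] witness the positivity of these cubes
   inside [S]. *)
Lemma pos_neg_parts S x : unital_operator_algebra S -> S x -> star x = x ->
  exists p q np nq, [/\ [/\ S p, S q, S np & S nq],
    [/\ star p = p, star q = q, star np = np & star nq = nq],
    [/\ x = p - q, p * q = 0 & q * p = 0],
    p * p * p = np * np /\ q * q * q = nq * nq & spos (p + q)].
Proof.
move=> hS Sx xsa.
have hT := subalgI hS (commutant_subalg x).
have Tx : (S `&` commutant x) x by [].
(* [A] is |x|, the root of x^2, and [m] is the root of |x|; the parts are (|x| + x) / 2 and (|x| -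
   x) / 2. *)
have [A [TA Asa Apos AA]] := spos_sqrt hT (subalgM hT Tx Tx) (spos_sqr xsa).
have [m [[Sm mx] msa _ mm]] := spos_sqrt hT TA Apos.
have {}mx : m * x = x * m := mx.
pose c : R[i] := (2^-1)%:C.
have c2 : c + c = 1.
  by rewrite -rmorphD -[RHS](rmorph1 (real_complex R)); congr (_%:C); lra.
have mmx : m * m * x = x * (m * m) by rewrite -mulrA mx mulrA mx mulrA.
have mmm : m * m * (m * m) = x * x by rewrite mm AA.
pose p := c *: (m * m + x); pose q := c *: (m * m - x).
have ncc (y : C) : c *: y + c *: y = y by rewrite -scalerDl c2 scale1r.
have cmx (y : C) : m * y = y * m -> m * (c *: y) = (c *: y) * m.
  by move=> my; rewrite -scalerAl -scalerAr my.
have mp : m * p = p * m by apply: cmx; rewrite mulrDl mulrDr mx mulrA.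
have mq : m * q = q * m by apply: cmx; rewrite mulrBl mulrBr mx mulrA.
(* p^2 = |x| p, so p^3 = |x| p^2 = (m p)^2 is a square even before p is known to be positive. *)
have pp : p * p = m * m * p.
  have E : (m * m + x) * (m * m + x) = m * m * (m * m + x) + m * m * (m * m + x).
    by rewrite !(mulrDl, mulrDr) mmm mmx; ncalg; ring.
  by rewrite /p -scalerAl -!scalerAr E scalerDr ncc.
have qq : q * q = m * m * q.
  have E : (m * m - x) * (m * m - x) = m * m * (m * m - x) + m * m * (m * m - x).
    by rewrite !(mulrBl, mulrBr) mmm mmx; ncalg; ring.
  by rewrite /q -scalerAl -!scalerAr E scalerDr ncc.
have psa : star p = p by rewrite starZr starDE star_mul msa xsa.
have qsa : star q = q by rewrite starZr starB star_mul msa xsa.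
have Sp : S p by apply: subalgZ => //; apply: subalgD => //; apply: subalgM.
have Sq : S q by apply: subalgZ => //; apply: subalgB => //; apply: subalgM.
exists p, q, (m * p), (m * q); split; [split|split|split|split|].
- by [].
- by [].
- exact: subalgM.
- exact: subalgM.
- by [].
- by [].
- by rewrite star_mul psa msa mp.
- by rewrite star_mul qsa msa mq.
- have -> : p - q = c *: x + c *: x by rewrite /p /q; ncalg; ring.
  by rewrite ncc.
- have E : (m * m + x) * (m * m - x) = 0.
    by rewrite mulrDl !mulrBr mmm mmx; ncalg; ring.
  by rewrite /p /q -scalerAl -scalerAr E !scaler0.
- have E : (m * m - x) * (m * m + x) = 0.
    by rewrite mulrBl !mulrDr mmm mmx; ncalg; ring.
  by rewrite /p /q -scalerAl -scalerAr E !scaler0.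
- have -> : m * p * (m * p) = m * m * (p * p).
    by rewrite -!mulrA; congr (_ * _); rewrite !mulrA mp.
  by rewrite {1}pp -mulrA.
- have -> : m * q * (m * q) = m * m * (q * q).
    by rewrite -!mulrA; congr (_ * _); rewrite !mulrA mq.
  by rewrite {1}qq -mulrA.
- rewrite /p /q -scalerDr addrACA subrr addr0 scalerDr ncc.
  by rewrite mm.
Qed.

Lemma normR_cube_eq0 x : star x = x -> x * x * x = 0 -> x = 0.
Proof.
move=> xsa x3.
have xx : star (x * x) = x * x by rewrite star_mul xsa.
have : normR (x * x * (x * x)) = 0 by rewrite mulrA x3 mul0r normR0.
rewrite normR_sqr // normR_sqr // => /eqP.
by rewrite !expf_eq0 /= => /eqP/normR_eq0.
Qed.

(** A contradiction obtained without spectra. If P = - star y * y >= 0, then Q = y * star y = P + 2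
    (Re y)^2 + 2 (Im y)^2 >= 0. Now Q^2 + Q^3 = y (1 - P) star y * y * star y has norm at most 1,
    and Q^2 - Q^3 = Q (1 - Q) Q >= 0, whence |2 Q^3| <= 1. But |Q| = 1 forces |Q^4| = 1, hence |Q^3|
    >= 1. *)
Lemma spos_unit_starM y : normR y = 1 -> ~ spos (- (star y * y)).
Proof.
move=> y1 Ppos.
pose P := - (star y * y); pose Q := y * star y.
have P1 : normR P = 1 by rewrite normRN normR_starM y1 expr1n.
have Psub : normR (1 - P) <= 1.
  have [h [_ hsa _ hP]] := spos_sqrt (subalgT C) I Ppos.
  have h1 : normR h <= 1.
    rewrite -(@expr_le1 _ 2) ?normR_ge0 // -normR_sqr // hP -/P P1.
    exact: lexx.
  have := contraction_double_sqr hsa h1; rewrite hP -/P => PP.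
  have -> : 1 - P = (2^-1)%:C *: (1 + (1 - 2%:C *: P)).
    rewrite fmorphV; ncalg; field; rewrite ?realC_neq0 //.
  rewrite normRZr ger0_norm ?invr_ge0 // ler_pdivrMl // mulr1.
  by rewrite (le_trans (normRD _ _)) // normR1 -[leRHS]/(1 + 1) lerD2l.
have Qsa : star Q = Q by rewrite star_mul starK.
have Q1 : normR Q = 1 by rewrite /Q -{1}(starK y) normR_starM normR_star y1 expr1n.
have Qpos : spos Q.
  pose h := (2^-1)%:C *: (y + star y); pose j := (2^-1)%:C *: (y - star y).
  pose k := 'i%C *: j.
  have hsa : star h = h by rewrite starZr starDE starK addrC.
  have ksa : star k = k.
    rewrite /k starZ starZr starB starK.
    have -> : Num.conj ('i%C : R[i]) = - 'i%C by rewrite complexiE conjCi.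
    by rewrite scaleNr -scalerN -scalerN opprB.
  have kk : k * k = - (j * j).
    by rewrite /k -scalerAl -scalerAr scalerA -expr2 sqr_i scaleN1r.
  have -> : Q = P + (2%:C *: (h * h) + 2%:C *: (k * k)).
    rewrite kk /P /Q /h /j fmorphV; ncalg; field; rewrite ?realC_neq0 //.
  apply: spos_add => //; apply: spos_add; apply: spos_scale => //; exact: spos_sqr.
have bound : normR (Q * Q + Q * Q * Q) <= 1.
  have -> : Q * Q + Q * Q * Q = y * (1 - P) * (star y * y * star y).
    by rewrite /P /Q; ncalg; ring.
  rewrite (le_trans (normRM _ _)) // mulr_ile1 ?normR_ge0 //.
    by rewrite (le_trans (normRM _ _)) // y1 mul1r.
  rewrite (le_trans (normRM _ _)) // mulr_ile1 ?normR_ge0 ?normR_star ?y1 //.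
  by rewrite normR_starM y1 expr1n.
have Q3pos : spos (Q * Q * Q).
  have [h [hQ hsa _ hh]] := spos_sqrt (commutant_subalg Q) (erefl _) Qpos.
  have {}hQ : h * Q = Q * h := hQ.
  have -> : Q * Q * Q = (h * Q) * (h * Q).
    by rewrite {1}hQ mulrA -[Q * h * h]mulrA hh.
  by apply: spos_sqr; rewrite star_mul hsa Qsa.
have diff : spos (Q * Q + Q * Q * Q - 2%:C *: (Q * Q * Q)).
  have Qsub : spos (1 - Q).
    by rewrite -[1](scale1r (1 : C)); apply: (@spos_subr 1); rewrite ?Q1.
  have QQ : (commutant Q) (1 - Q) by rewrite /commutant /= mulrBl mulrBr mul1r mulr1.
  have [h [hQ hsa _ hh]] := spos_sqrt (commutant_subalg Q) QQ Qsub.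
  have {}hQ : h * Q = Q * h := hQ.
  have -> : Q * Q + Q * Q * Q - 2%:C *: (Q * Q * Q) = (Q * h) * (Q * h).
    rewrite -{2}hQ mulrA -[Q * h * h]mulrA hh -[2]/(1 + 1) rmorphD rmorph1.
    by ncalg; ring.
  by apply: spos_sqr; rewrite star_mul hsa Qsa.
have sa3 : star (Q * Q * Q) = Q * Q * Q by rewrite star_mul (star_mul Q Q) Qsa mulrA.
have Q3 : normR (2%:C *: (Q * Q * Q)) <= 1.
  apply: spos_norm => //; first exact: spos_scale.
  have -> : 1%:C *: 1 - 2%:C *: (Q * Q * Q) =
      (1%:C *: 1 - (Q * Q + Q * Q * Q)) +
      (Q * Q + Q * Q * Q - 2%:C *: (Q * Q * Q)) by ncalg; ring.
  apply: spos_add => //; apply: spos_subr => //.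
  by rewrite starDE sa3 star_mul Qsa.
have : normR (Q * Q * (Q * Q)) = 1.
  have QQsa : star (Q * Q) = Q * Q by rewrite (star_mul Q Q) Qsa.
  by rewrite (normR_sqr QQsa) (normR_sqr Qsa) Q1 !expr1n.
rewrite mulrA => Q4.
have := normRM (Q * Q * Q) Q; rewrite Q4 Q1 mulr1.
by move: Q3; rewrite normRZr ger0_norm //; lra.
Qed.

Lemma spos_opp_starM y : spos (- (star y * y)) -> y = 0.
Proof.
move=> ypos; apply: normR_eq0; apply/eqP/negPn/negP => y0.
have yp : 0 < normR y by rewrite lt_def y0 normR_ge0.
pose r := (normR y)^-1.
have r0 : 0 <= r by rewrite invr_ge0 normR_ge0.
apply: (@spos_unit_starM (r%:C *: y)).
  by rewrite normRZr ger0_norm // mulVf.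
rewrite starZr -scalerAl -scalerAr -!scalerN.
by do 2 apply: spos_scale => //.
Qed.

(** Write x = star y * y = p - q with p q = 0. Then star (y q) * (y q) = - q^3, and [spos_opp_starM]
    gives y q = 0, so q^3 = 0 and q = 0. *)
Lemma cnonneg_spos x : cnonneg x <-> spos x.
Proof.
split=> [[y xE]|xpos]; last first.
  have [h [_ hsa _ hx]] := spos_sqrt (subalgT C) I xpos.
  by exists h; rewrite hsa hx.
have xsa : star x = x by rewrite xE star_mul starK.
have [p [q [np [nq [_ [psa qsa npsa nqsa] [xpq pq qp] [p3 q3] pqpos]]]]] :=
  pos_neg_parts (subalgT C) I xsa.
have yq : star (y * q) * (y * q) = - (q * q * q).
  rewrite star_mul qsa -mulrA [star y * _]mulrA -xE xpq mulrBl pq sub0r mulrN.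
  by rewrite mulrA.
have q0 : q = 0.
  apply: normR_cube_eq0 => //; apply: oppr_inj; rewrite -yq.
  suff -> : y * q = 0 by rewrite mulr0 oppr0.
  by apply: spos_opp_starM; rewrite yq opprK q3; apply: spos_sqr.
by move: pqpos; rewrite xpq q0 subr0 addr0.
Qed.

Lemma cnonneg_sa x : cnonneg x -> star x = x.
Proof. by move=> /cnonneg_spos[]. Qed.

Lemma cnonnegD x y : cnonneg x -> cnonneg y -> cnonneg (x + y).
Proof. by rewrite !cnonneg_spos; apply: spos_add. Qed.

Lemma cnonnegZ r x : 0 <= r -> cnonneg x -> cnonneg (r%:C *: x).
Proof. by rewrite !cnonneg_spos; apply: spos_scale. Qed.

Lemma cnonneg_starM y : cnonneg (star y * y).
Proof. by exists y. Qed.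

Lemma cnonneg_conj x z : cnonneg x -> cnonneg (star z * x * z).
Proof. by move=> [y ->]; exists (y * z); rewrite star_mul !mulrA. Qed.

Lemma cnonneg_real r : 0 <= r -> cnonneg (r%:C *: 1 : C).
Proof. by rewrite cnonneg_spos; apply: spos_real. Qed.

Lemma cnonneg_subr r x : star x = x -> normR x <= r -> cnonneg (r%:C *: 1 - x).
Proof. by rewrite cnonneg_spos; apply: spos_subr. Qed.

Lemma cnonneg_norm r x : 0 <= r -> cnonneg x -> cnonneg (r%:C *: 1 - x) ->
  normR x <= r.
Proof. by rewrite !cnonneg_spos; apply: spos_norm. Qed.

Lemma cnonneg_norm_starM r y : 0 <= r -> cnonneg (r%:C *: 1 - star y * y) ->
  normR y ^+ 2 <= r.
Proof.
by move=> r0 /(cnonneg_norm r0 (cnonneg_starM y)); rewrite normR_starM.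
Qed.

Lemma cnonneg_subr_starM r y : normR y ^+ 2 <= r ->
  cnonneg (r%:C *: 1 - star y * y).
Proof.
by move=> yr; apply: cnonneg_subr; rewrite ?normR_starM // star_mul starK.
Qed.

End Order.

(** * Moebius transformations of the unit ball *)

Section Moebius.
Variables (R : realType) (C : cstarAlgType R).
Implicit Types (a b c d u v x y z s : C) (A D S : set C) (r t : R).

Lemma contraction_of_defect b : cnonneg (1 - star b * b) -> normR b <= 1.
Proof.
move=> bpos; rewrite -(@expr_le1 _ 2) ?normR_ge0 //; apply: cnonneg_norm_starM => //.
by rewrite rmorph1 scale1r.
Qed.

Lemma left_right_inv x y z : x * y = 1 -> z * x = 1 -> z = y.
Proof. by move=> xy zx; rewrite -[z]mulr1 -xy mulrA zx mul1r. Qed.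

Lemma star_inv x y : star x = x -> x * y = 1 -> y * x = 1 -> star y = y.
Proof.
move=> xsa xy yx; apply: (left_right_inv xy).
by rewrite -{1}xsa -star_mul xy star1.
Qed.

(** [s] plays the role of the defect operator of [d], the root of [1 - star d * d], and [s'] is its
    inverse. *)
Definition defect_root d s s' :=
  [/\ star s = s, star s' = s', s * s' = 1, s' * s = 1 &
      s * s = 1 - star d * d].

Lemma defect_root_exists D d : unital_cstar_subalgebra D -> D d -> normR d < 1 ->
  exists s s', [/\ D s, D s', cnonneg s & defect_root d s s'].
Proof.
move=> [hD Dstar] Dd d1.
have d2 : normR (star d * d) < 1.
  by rewrite normR_starM expr_lt1 ?normR_ge0.
have Ddd : D (star d * d) by apply: subalgM => //; apply: Dstar.
have ddsa : star (star d * d) = star d * d by rewrite star_mul starK.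
have [b [Db bsa bb b1]] := sqrt_one_sub hD Ddd ddsa (ltW d2).
have b1' : normR b < 1.
  by rewrite (le_lt_trans b1) // ltrBlDl ltrDr sqrtr_gt0 subr_gt0.
have [y [Dy by1 yb1 _]] := neumann hD Db b1'.
have sa : star (1 - b) = 1 - b by rewrite starB star1 bsa.
exists (1 - b), y; split => //.
- by apply: subalgB => //; apply: subalg1.
- rewrite -[1](scale1r (1 : C)); apply: (@cnonneg_subr R C 1) => //.
  exact: ltW.
- by split => //; apply: star_inv sa _ _.
Qed.

(** E and F are the inverses of [1 - star d * d] and [1 - d * star d]; all four identities come from
    (1 - star d * d) * star d = star d * (1 - d * star d). *)
Lemma defect_root_intertwine d s s' c c' :
  defect_root d c c' -> defect_root (star d) s s' ->
  let E := c' * c' in let F := s' * s' in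
  [/\ E * star d = star d * F, d * E = F * d, E = 1 + star d * F * d &
      F = 1 + d * E * star d].
Proof.
move=> [csa c'sa cc' c'c cE] [ssa s'sa ss' s's sF] E F.
rewrite starK in sF.
have EL : E * (1 - star d * d) = 1.
  by rewrite -cE /E -mulrA [c' * (c * c)]mulrA c'c mul1r.
have FR : (1 - d * star d) * F = 1.
  by rewrite -sF /F -mulrA [s * (s' * s')]mulrA ss' mul1r.
have Esa : star E = E by rewrite star_mul c'sa.
have Fsa : star F = F by rewrite star_mul s'sa.
have EdF : E * star d = star d * F.
  have -> : E * star d = E * (star d * (1 - d * star d)) * F.
    by rewrite -!mulrA FR mulr1.
  have -> : star d * (1 - d * star d) = (1 - star d * d) * star d by ncalg; ring.
  by rewrite [E * _]mulrA EL mul1r.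
have dEF : d * E = F * d.
  have := congr1 (@star R C) EdF.
  by rewrite (star_mul E) (star_mul (star d)) starK Esa Fsa.
split => //.
  by rewrite -EdF -{1}EL; ncalg; ring.
by rewrite -mulrA EdF -{1}FR; ncalg; ring.
Qed.

Lemma moebius_defect a d u s s' c c' :
  defect_root d c c' -> defect_root (star d) s s' ->
  (1 - star d * a) * u = 1 ->
  let b := s' * (a - d) * u * c in
  1 - star b * b = star (u * c) * (1 - star a * a) * (u * c).
Proof.
move=> hc hs ua b.
have [Ed dE EE FF] := defect_root_intertwine hc hs.
have [csa c'sa cc' c'c cE] := hc; have [ssa s'sa ss' s's sF] := hs.
have ua' : star u * (1 - star a * d) = 1.
  by have := congr1 (@star R C) ua; rewrite star_mul starB star1 star_mul starK.
pose E := c' * c'; pose F := s' * s'.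
rewrite -/E -/F in Ed dE EE FF.
(* Denominators are cleared. Sorted by [a] and [star a], the coefficients are 1, 0, 0 and -1 by the
   intertwining identities. *)
have T : (1 - star a * d) * E * (1 - star d * a)
    - (star a - star d) * F * (a - d) = 1 - star a * a.
  have E1 : E - star d * F * d = 1 by rewrite {1}EE addrK.
  have E2 : d * E - F * d = 0 by rewrite dE subrr.
  have E3 : E * star d - star d * F = 0 by rewrite Ed subrr.
  have E4 : d * E * star d - F = -1 by rewrite FF opprD addrCA subrr addr0.
  transitivity ((E - star d * F * d) - star a * (d * E - F * d)
    - (E * star d - star d * F) * a + star a * (d * E * star d - F) * a).
    by ncalg; ring.
  by rewrite E1 E2 E3 E4 !(mulr0, mul0r) !subr0 mulrN1 mulNr.
rewrite -T mulrBr mulrBl; congr (_ - _).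
  have -> : star (u * c) * ((1 - star a * d) * E * (1 - star d * a)) * (u * c) =
      c * (star u * (1 - star a * d)) * E * ((1 - star d * a) * u) * c.
    by rewrite star_mul csa; ncalg; ring.
  by rewrite ua ua' !mulr1 /E mulrA cc' mul1r c'c.
by rewrite /b /F !star_mul starB csa s'sa; ncalg; ring.
Qed.


(** For a scalar centre the defect of the transform is (1 - r^2) star u * (1 - star a * a) * u: no
    root is involved, and [a] may have norm 1. *)
Lemma scalar_moebius_contraction r a u :
  -1 < r -> r < 1 -> normR a <= 1 -> (1 - r%:C *: a) * u = 1 ->
  normR ((a - r%:C *: 1) * u) <= 1.
Proof.
move=> r0 r1 a1 ua; apply: contraction_of_defect.
have ua' : star u * (1 - r%:C *: star a) = 1.
  by have := congr1 (@star R C) ua; rewrite star_mul starB star1 starZr.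
have -> : 1 - star ((a - r%:C *: 1) * u) * ((a - r%:C *: 1) * u) =
    (1 - r ^+ 2)%:C *: (star u * (1 - star a * a) * u).
  have one : 1 = (star u * (1 - r%:C *: star a)) * ((1 - r%:C *: a) * u).
    by rewrite ua' ua mulr1.
  rewrite star_mul starB starZr star1 [X in X - _]one.
  by rewrite rmorphB rmorph1 rmorphXn /=; ncalg; ring.
apply: cnonnegZ; first by nra.
apply: cnonneg_conj; rewrite -[1](scale1r (1 : C)); apply: (@cnonneg_subr_starM R C 1).
by rewrite expr_le1 ?normR_ge0.
Qed.

End Moebius.

(** * Characters *)

Section OpnormOn.
Variables (R : realType) (C : cstarAlgType R).
Implicit Types (S : set C) (T : C -> C) (r k : R).

Lemma opnorm_on_bound S T r : 0 < r -> (opnorm_on S T < r%:E)%E ->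
  exists k, [/\ 0 <= k, k < r & forall x, S x -> `|x| <= 1 -> normR (T x) <= k].
Proof.
move=> r0; rewrite /opnorm_on; set E := [set _ | _ in _] => Er.
have ub x : S x -> `|x| <= 1 -> ((normR (T x))%:E <= ereal_sup E)%E.
  by move=> Sx x1; apply: ereal_sup_ubound; exists x.
case: (ereal_sup E) Er ub => [m| |] Er ub.
- exists (Num.max 0 m); split; rewrite ?le_max ?lexx ?gt_max ?r0 //.
  by move=> x Sx x1; rewrite le_max; apply/orP; right; rewrite -lee_fin; exact: ub.
- by [].
(* A supremum equal to -oo means an empty set of values, and the bound is vacuous. *)
- by exists 0; split => // x Sx /(ub x Sx); rewrite leeNy_eq.
Qed.

Lemma opnorm_on_lt S T k r : k < r ->
  (forall x, S x -> `|x| <= 1 -> normR (T x) <= k) -> (opnorm_on S T < r%:E)%E.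
Proof.
move=> kr kT; rewrite (@le_lt_trans _ _ k%:E) ?lte_fin //.
by apply: ge_ereal_sup => _ [x [Sx x1] <-]; rewrite lee_fin kT.
Qed.

Lemma le_of_scaling r k : 0 <= r ->
  (forall t, 0 < t -> t < 1 -> t * r <= k) -> r <= k.
Proof.
move=> r0 tr; rewrite leNgt; apply/negP => kr.
have k0 : 0 <= k.
  by apply: le_trans (tr 2^-1 _ _); rewrite ?mulr_ge0 ?invr_gt0 ?invf_lt1 ?ltr1n.
have rpos : 0 < r by exact: le_lt_trans k0 kr.
pose t := (k + r) / (2 * r).
have t0 : 0 < t by rewrite divr_gt0 //; lra.
have t1 : t < 1 by rewrite ltr_pdivrMr; lra.
have := tr t t0 t1; apply/negP; rewrite -ltNge.
have -> : t * r = (k + r) / 2 by rewrite /t; field; rewrite gt_eqF.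
lra.
Qed.

(** Moebius transforms centred at values of characters require norm below 1; homogeneity then
    carries a bound to the closed ball. *)
Lemma normR_ball_open S T k :
  (forall t x, S x -> S (t%:C *: x)) ->
  (forall t x, S x -> T (t%:C *: x) = t%:C *: T x) ->
  (forall x, S x -> normR x < 1 -> normR (T x) <= k) ->
  forall x, S x -> `|x| <= 1 -> normR (T x) <= k.
Proof.
move=> SZ TZ Tk x Sx; rewrite -[1]/(1%:C) ler_normR => x1.
apply: le_of_scaling; first exact: normR_ge0.
move=> t t0 t1.
have := Tk _ (SZ t _ Sx); rewrite TZ // !normRZr ger0_norm ?(ltW t0) //; apply.
by rewrite (le_lt_trans _ t1) // ler_piMr // ltW.
Qed.

End OpnormOn.

Section Characters.
Variables (R : realType) (C : cstarAlgType R) (A D : set C).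
Hypotheses (hA : unital_operator_algebra A) (hD : unital_cstar_subalgebra D).
Hypothesis hDA : D `<=` A.
Implicit Types (a b d u x y z : C) (Phi Psi : C -> C) (r t m k : R).

Section OneCharacter.
Variable Phi : C -> C.
Hypothesis hPhi : D_character A D Phi.

Lemma dchar0 : Phi 0 = 0.
Proof. by rewrite (dchar_id hPhi) //; case: hD => /subalg0. Qed.

Lemma dcharZ (k : R[i]) a : A a -> Phi (k *: a) = k *: Phi a.
Proof.
move=> Aa; rewrite -[k *: a]addr0 (dchar_linear hPhi) //; last exact: subalg0.
by rewrite dchar0 addr0.
Qed.

Lemma dcharD a b : A a -> A b -> Phi (a + b) = Phi a + Phi b.
Proof. by move=> Aa Ab; rewrite -[a]scale1r (dchar_linear hPhi) // !scale1r. Qed.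

Lemma dcharN a : A a -> Phi (- a) = - Phi a.
Proof. by move=> Aa; rewrite -(scaleN1r a) dcharZ // scaleN1r. Qed.

Lemma dcharB a b : A a -> A b -> Phi (a - b) = Phi a - Phi b.
Proof. by move=> Aa Ab; rewrite dcharD ?dcharN //; exact: subalgN. Qed.

Lemma dchar_normR a : A a -> normR (Phi a) <= normR a.
Proof. by move=> /(dchar_contr hPhi); rewrite !normRE lecR. Qed.

Lemma dchar_oneB a u : A a -> A u -> (1 - a) * u = 1 -> (1 - Phi a) * Phi u = 1.
Proof.
move=> Aa Au au; have A1 := subalg1 hA.
rewrite -[X in X - _](dchar_unit hPhi) -dcharB // -(dchar_mul hPhi) ?au //.
  exact: (dchar_unit hPhi).
exact: subalgB.
Qed.

Lemma dchar_Bone a u : A a -> A u -> u * (1 - a) = 1 -> Phi u * (1 - Phi a) = 1.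
Proof.
move=> Aa Au au; have A1 := subalg1 hA.
rewrite -[X in X - _](dchar_unit hPhi) -dcharB // -(dchar_mul hPhi) ?au //.
  exact: (dchar_unit hPhi).
exact: subalgB.
Qed.

End OneCharacter.

Definition kernel_bound Phi Psi k := forall a, A a -> Psi a = 0 -> normR a <= 1 ->
  normR (Phi a) <= k.

Section TwoCharacters.
Variables Phi Psi : C -> C.
Hypotheses (hPhi : D_character A D Phi) (hPsi : D_character A D Psi).

(** The coefficients [d], [s'], [c] lie in [D] and are fixed by every character. One element [b]
    serves all characters, so [Phi b] and [Psi b] can be compared. *)
Lemma moebius_character d : D d -> normR d < 1 -> forall s s' c c',
  D s' -> D c -> defect_root d c c' -> defect_root (star d) s s' ->
  forall a, A a -> normR a < 1 ->
  exists b, [/\ A b, normR b <= 1 & forall Theta, D_character A D Theta ->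
    exists2 v, (1 - star d * Theta a) * v = 1 /\ v * (1 - star d * Theta a) = 1 &
      Theta b = s' * (Theta a - d) * v * c].
Proof.
move=> Dd d1 s s' c c' Ds' Dc hc hs a Aa a1.
have Dsd : D (star d) by apply: (proj2 hD).
have Ada : A (star d * a) by apply: subalgM => //; apply: hDA.
have da1 : normR (star d * a) < 1.
  rewrite (le_lt_trans (normRM _ _)) // normR_star.
  by rewrite mulr_ilt1 ?normR_ge0.
have [u [Au ua ua' _]] := neumann hA Ada da1.
have Aad : A (s' * (a - d)).
  by apply: subalgM => //; [exact: hDA | apply: subalgB => //; exact: hDA].
exists (s' * (a - d) * u * c); split.
- by apply: subalgM => //; [exact: subalgM | exact: hDA].
- apply: contraction_of_defect; rewrite (moebius_defect hc hs ua).
  apply: cnonneg_conj; rewrite -[1](scale1r (1 : C)).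
  apply: (@cnonneg_subr_starM R C 1); rewrite expr_le1 ?normR_ge0 //; exact: ltW.
move=> Theta hT; exists (Theta u).
  have TE : Theta (star d * a) = star d * Theta a.
    by rewrite (dchar_mul hT (hDA Dsd) Aa) (dchar_id hT Dsd).
  by rewrite -TE; split; [exact: dchar_oneB | exact: dchar_Bone].
have Ad := hDA Dd; have As' := hDA Ds'; have Ac := hDA Dc.
have Asau : A (s' * (a - d) * u) by exact: subalgM.
rewrite (dchar_mul hT Asau Ac) (dchar_mul hT Aad Au) (dchar_mul hT As') ?(dcharB hT Aa Ad).
  by rewrite (dchar_id hT Ds') (dchar_id hT Dc) (dchar_id hT Dd).
exact: subalgB.
Qed.

(* Schwarz-Pick: the Moebius transform of [a] centred at [Psi a] lies in [Ker Psi]. *)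
Lemma kernel_bound_defect k a :
  0 <= k -> k <= 1 -> kernel_bound Phi Psi k -> A a -> normR a < 1 ->
  let x := Phi a in let y := Psi a in let z := 1 - star y * x in
  cnonneg (1 - star x * x - (1 - k ^+ 2)%:C *: (star z * z)).
Proof.
move=> k0 k1 hk Aa a1 x y z.
have Dy : D y := dchar_codom hPsi Aa.
have y1 : normR y < 1 := le_lt_trans (dchar_normR hPsi Aa) a1.
have [c [c' [Dc Dc' _ hc]]] := defect_root_exists hD Dy y1.
have [s [s' [Ds Ds' _ hs]]] : exists s s',
    [/\ D s, D s', cnonneg s & defect_root (star y) s s'].
  by apply: (@defect_root_exists R C D) => //; [exact: (proj2 hD) | rewrite normR_star].
have [b [Ab b1 Tb]] := moebius_character Dy y1 Ds' Dc hc hs Aa a1.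
have [v [zv vz] Phib] := Tb _ hPhi.
have [v' _ Psib] := Tb _ hPsi.
rewrite -/x -/z in zv vz Phib.
have {}Psib : Psi b = 0 by rewrite Psib subrr mulr0 !mul0r.
have kb := hk _ Ab Psib b1.
have : cnonneg ((k ^+ 2)%:C *: 1 - star (Phi b) * Phi b).
  by apply: cnonneg_subr_starM; rewrite ler_pXn2r ?nnegrE ?normR_ge0.
rewrite Phib.
have := moebius_defect hc hs zv; rewrite /= => dE.
set M := s' * _ * _ * _ in dE *.
have [Ed dE' EE FF] := defect_root_intertwine hc hs.
have [csa c'sa cc' c'c cE] := hc; have [ssa s'sa ss' s's sF] := hs.
move=> Mpos.
have {}Mpos : cnonneg (star (v * c) * (1 - star x * x) * (v * c) - (1 - k ^+ 2)%:C *: 1).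
  rewrite -dE.
  have -> // : 1 - star M * M - (1 - k ^+ 2)%:C *: 1 = (k ^+ 2)%:C *: 1 - star M * M.
  by rewrite rmorphB rmorph1; ncalg; ring.
(* c' z is the inverse of v c, so this conjugation removes the denominators. *)
have := cnonneg_conj (c' * z) Mpos.
have vccz : v * c * (c' * z) = 1.
  by rewrite -mulrA [c * _]mulrA cc' mul1r.
have -> : star (c' * z) * (star (v * c) * (1 - star x * x) * (v * c)
    - (1 - k ^+ 2)%:C *: 1) * (c' * z) =
   star (v * c * (c' * z)) * (1 - star x * x) * (v * c * (c' * z))
    - (1 - k ^+ 2)%:C *: (star z * (c' * c') * z).
  by rewrite !star_mul c'sa; ncalg; ring.
rewrite vccz star1 mul1r mulr1 EE => xpos.
(* By [EE] the square of [c'] is 1 plus a positive term, which may be dropped. *)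
have -> : 1 - star x * x - (1 - k ^+ 2)%:C *: (star z * z) =
    (1 - star x * x - (1 - k ^+ 2)%:C *: (star z * (1 + star y * (s' * s') * y) * z))
    + (1 - k ^+ 2)%:C *: (star (s' * y * z) * (s' * y * z)).
  by rewrite !star_mul s'sa; ncalg; ring.
apply: cnonnegD => //; apply: cnonnegZ; last exact: cnonneg_starM.
by rewrite subr_ge0 expr_le1.
Qed.

End TwoCharacters.
End Characters.

(** * Kernel bounds against the norm of the difference *)

Section Characters.
Variables (R : realType) (C : cstarAlgType R) (A D : set C).
Hypotheses (hA : unital_operator_algebra A) (hD : unital_cstar_subalgebra D).
Hypothesis hDA : D `<=` A.
Implicit Types (a b d u x y z : C) (Phi Psi : C -> C) (r t m k : R).

Section TwoCharacters.
Variables Phi Psi : C -> C.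
Hypotheses (hPhi : D_character A D Phi) (hPsi : D_character A D Psi).

(** Write |w|^2 for [star w * w]. The parallelogram identity gives Q = 4 - |x - y|^2 - 2 ka |z|^2,
    which is good for large z, while S = z + star z - |x - y|^2 is good for small z. In the
    combination of Q and S with weights l and 1 - l, adding (1 - l) / 2 times T = |z - 2|^2 cancels
    the terms linear in z; those in |z|^2 cancel when (1 - l) / 2 = 2 l ka, that is l = 1 / (1 + 4
    ka), leaving 2 + 2 l - |x - y|^2. *)
Lemma kernel_bound_diff k a : 0 <= k -> k < 1 -> kernel_bound A Phi Psi k ->
  A a -> normR a < 1 ->
  normR (Phi a - Psi a) ^+ 2 <= 2 + 2 / (1 + 4 * (1 - k ^+ 2)).
Proof.
move=> k0 k1 hk Aa a1.
have /= := kernel_bound_defect hA hD hDA hPhi hPsi k0 (ltW k1) hk Aa a1.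
set x := Phi a; set y := Psi a; set z := 1 - star y * x; set ka := 1 - k ^+ 2.
move=> P1.
have ka0 : 0 < ka by rewrite subr_gt0 expr_lt1.
have P2 : cnonneg (1 - star y * y).
  rewrite -[1](scale1r (1 : C)); apply: (@cnonneg_subr_starM R C 1).
  by rewrite expr_le1 ?normR_ge0 // (le_trans (dchar_normR hPsi Aa)) // ltW.
set l := (1 + 4 * ka)^-1.
have l0 : 0 < l by rewrite invr_gt0; lra.
have l1 : l < 1 by rewrite invf_lt1; lra.
have lka : (1 - l) / 2 = 2 * (l * ka) by rewrite /l; field; lra.
apply: cnonneg_norm_starM; first lra.
pose Q := 2%:C *: (1 - star x * x - ka%:C *: (star z * z)) +
  2%:C *: (1 - star y * y) + star (x + y) * (x + y).
pose S := 1 - star x * x - ka%:C *: (star z * z) + (1 - star y * y) +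
  ka%:C *: (star z * z).
pose T := star (z - 2%:C *: 1) * (z - 2%:C *: 1).
have SE : S = z + star z - star (x - y) * (x - y).
  by rewrite /S /z !starB star1 star_mul starK; ncalg; ring.
have -> : (2 + 2 * l)%:C *: 1 - star (x - y) * (x - y) =
    l%:C *: Q + (1 - l)%:C *: S + ((1 - l) / 2)%:C *: T.
  have -> : l%:C *: Q = l%:C *: (4%:C *: 1 - star (x - y) * (x - y))
     - (2 * (l * ka))%:C *: (star z * z).
    by rewrite /Q; move: (z) => v; rewrite !starB !starDE; ncalg; ring.
  rewrite SE lka /T; move: (z) => {SE P1 S Q T}z.
  have -> : (1 - l)%:C = (4 * (l * ka))%:C :> R[i] by congr (_%:C); lra.
  have lE : l = 1 - 4 * (l * ka) by lra.
  rewrite [in LHS]lE [X in X%:C *: (_ - star _ * _)]lE !starB starZr star1.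
  by move: (l * ka) => t; ncalg; ring.
apply: cnonnegD; last by apply: cnonnegZ; [lra | exact: cnonneg_starM].
apply: cnonnegD; apply: cnonnegZ; try lra.
- apply: cnonnegD; last exact: cnonneg_starM.
  by apply: cnonnegD; apply: cnonnegZ.
- apply: cnonnegD; first exact: cnonnegD.
  by apply: cnonnegZ (ltW ka0) _; exact: cnonneg_starM.
Qed.

(** The hypothesis at the transform yields (1 - r^2) e <= m (1 - r e), hence e <= m / (1 - r^2 + m
    r). The choice r = m / 2 maximizes the denominator, giving 1 + m^2 / 4; the root appears because
    |e| = |Phi a0|^2. The quotient is below 1 since (1 - m / 2)^2 > 0. *)
Lemma diff_bound_kernel m : 0 <= m -> m < 2 ->
  (forall a, A a -> normR a <= 1 -> normR (Phi a - Psi a) <= m) ->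
  kernel_bound A Phi Psi (Num.sqrt (m / (1 + m ^+ 2 / 4))).
Proof.
move=> m0 m2 hm a0 Aa0 Psia0 a01.
pose r := m / 2.
have r0 : 0 <= r by rewrite divr_ge0.
have r1 : r < 1 by rewrite ltr_pdivrMr // mul1r.
pose a := star (Phi a0) * a0; pose e := star (Phi a0) * Phi a0.
have Ds : D (star (Phi a0)) by apply: (proj2 hD); exact: (dchar_codom hPhi).
have Aa : A a by apply: subalgM => //; exact: hDA.
have a1 : normR a <= 1.
  rewrite (le_trans (normRM _ _)) // normR_star mulr_ile1 ?normR_ge0 //.
  by rewrite (le_trans (dchar_normR hPhi Aa0)).
have Phia : Phi a = e by rewrite (dchar_mul hPhi (hDA Ds) Aa0) (dchar_id hPhi Ds).
have Psia : Psi a = 0.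
  by rewrite (dchar_mul hPsi (hDA Ds) Aa0) Psia0 mulr0.
have Ara : A (r%:C *: a) by exact: subalgZ.
have ra1 : normR (r%:C *: a) < 1.
  by rewrite normRZr ger0_norm // (le_lt_trans _ r1) // ler_piMr.
have [u [Au ua ua' _]] := neumann hA Ara ra1.
have Ab : A (a - r%:C *: 1) by apply: subalgB => //; exact: subalgC.
have b1 : normR ((a - r%:C *: 1) * u) <= 1.
  by apply: scalar_moebius_contraction => //; lra.
have := hm _ (subalgM hA Ab Au) b1.
set f := Phi u.
have ef : (1 - r%:C *: e) * f = 1.
  by have := dchar_oneB hA hD hPhi Ara Au ua; rewrite (dcharZ hA hD hPhi _ Aa) Phia.
have fe : f * (1 - r%:C *: e) = 1.
  by have := dchar_Bone hA hD hPhi Ara Au ua'; rewrite (dcharZ hA hD hPhi _ Aa) Phia.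
have Psiu : Psi u = 1.
  have := dchar_oneB hA hD hPsi Ara Au ua.
  by rewrite (dcharZ hA hD hPsi _ Aa) Psia scaler0 subr0 mul1r.
have A1 := subalg1 hA.
have Ar : A (r%:C *: 1) by exact: subalgC.
rewrite (dchar_mul hPhi Ab Au) (dchar_mul hPsi Ab Au) Psiu -/f.
rewrite (dcharB hA hD hPhi Aa Ar) (dcharB hA hD hPsi Aa Ar) Phia Psia.
rewrite (dcharZ hA hD hPhi _ A1) (dcharZ hA hD hPsi _ A1).
rewrite (dchar_unit hPhi) (dchar_unit hPsi) sub0r mulr1 opprK.
have -> : (e - r%:C *: 1) * f + r%:C *: 1 = (1 - r ^+ 2)%:C *: (e * f).
  by rewrite -[in X in _ + r%:C *: X]ef rmorphB rmorph1 rmorphXn; ncalg; ring.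
move=> gm.
have esa : star e = e by rewrite star_mul starK.
have resa : star (1 - r%:C *: e) = 1 - r%:C *: e by rewrite starB starZr star1 esa.
have fsa : star f = f by apply: star_inv resa ef fe.
have eef : e * f = f * e.
  have e1 : e * (1 - r%:C *: e) = (1 - r%:C *: e) * e by ncalg; ring.
  by rewrite -[LHS]mul1r -fe -mulrA [(1 - _) * _]mulrA -e1 -!mulrA ef mulr1.
have gpos : cnonneg (m%:C *: 1 - (1 - r ^+ 2)%:C *: (e * f)).
  by apply: cnonneg_subr; rewrite // starZr star_mul fsa esa eef.
have e1 : normR (r%:C *: e) <= 1.
  have := dchar_normR hPhi Ara; rewrite (dcharZ hA hD hPhi _ Aa) Phia => /le_trans; apply.
  exact: ltW.
have repos : spos (1 - r%:C *: e).
  by rewrite -[1](scale1r (1 : C)); apply: (@spos_subr R C 1); rewrite ?starZr ?esa.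
have ce : commutant e (1 - r%:C *: e) by rewrite /commutant /=; ncalg; ring.
(* Conjugation by this root of 1 - r e, which commutes with e and f, cancels f. *)
have [q [qe qsa _ qq]] := spos_sqrt (commutant_subalg e) ce repos.
have {}qe : q * e = e * q := qe.
have qre : q * (1 - r%:C *: e) = (1 - r%:C *: e) * q.
  by rewrite -qq mulrA.
have qf : q * f = f * q.
  by rewrite -[LHS]mul1r -fe -mulrA [(1 - _) * _]mulrA -qre -!mulrA ef mulr1.
have := cnonneg_conj q gpos; rewrite qsa.
have -> : q * (m%:C *: 1 - (1 - r ^+ 2)%:C *: (e * f)) * q =
    m%:C *: (q * q) - (1 - r ^+ 2)%:C *: (q * e * f * q) by ncalg; ring.
rewrite -[q * e * f * q]mulrA -qf qe -mulrA [q * (q * f)]mulrA qq ef mulr1 => qpos.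
have d0 : 0 < 1 + m ^+ 2 / 4 by rewrite ltr_pwDl // divr_ge0 // sqr_ge0.
have kpos : 0 <= m / (1 + m ^+ 2 / 4) by rewrite divr_ge0 // ltW.
have : cnonneg ((m / (1 + m ^+ 2 / 4))%:C *: 1 - e).
  have -> : (m / (1 + m ^+ 2 / 4))%:C *: 1 - e = ((1 + m ^+ 2 / 4)^-1)%:C *:
     (m%:C *: (1 - r%:C *: e) - (1 - r ^+ 2)%:C *: e).
    have dE : (1 + m ^+ 2 / 4)^-1 * (m * r + (1 - r ^+ 2)) = 1.
      by rewrite /r; field; rewrite gt_eqF //; nra.
    move: (1 + m ^+ 2 / 4)^-1 dE => d dE.
    rewrite [X in _ - X = _](_ : e = (d * (m * r + (1 - r ^+ 2)))%:C *: e).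
      by ncalg; ring.
    by rewrite dE scale1r.
  by apply: cnonnegZ => //; rewrite invr_ge0 ltW.
move=> /(cnonneg_norm_starM kpos) le_k.
by rewrite -(ger0_norm (normR_ge0 (Phi a0))) -sqrtr_sqr ler_sqrt.
Qed.

End TwoCharacters.
End Characters.

(** * Hyperbolic distance *)

Section HypDist.
Variables (R : realType) (C : cstarAlgType R).
Implicit Types (a b c d u v x y z s : C) (A D S : set C) (r t k : R).

Lemma normR_isometryl u z : star u * u = 1 -> normR (u * z) = normR z.
Proof.
move=> uu; apply/eqP; rewrite -(@eqrXn2 _ 2) ?normR_ge0 // -!normR_starM.
by rewrite star_mul -mulrA [star u * _]mulrA uu mul1r.
Qed.

Lemma normR_isometryr u z : u * star u = 1 -> normR (z * u) = normR z.
Proof.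
move=> uu; rewrite -normR_star star_mul normR_isometryl ?normR_star //.
by rewrite starK.
Qed.

Lemma cinvE x y : x * y = 1 -> y * x = 1 -> cinv x = y.
Proof.
move=> xy yx; apply: xget_unique => // z [xz zx].
by rewrite -[z]mul1r -yx -mulrA xz mulr1.
Qed.

Lemma csqrtP x s : cnonneg s -> s * s = x ->
  star (csqrt x) = csqrt x /\ csqrt x * csqrt x = x.
Proof.
move=> s0 ss; have [r0 rr] : [set y | cnonneg y /\ y * y = x] (csqrt x).
  by apply: xgetPex; exists s.
by split => //; exact: cnonneg_sa.
Qed.

(* The square roots selected by [csqrt] differ from given self-adjoint ones by
   unitaries, which the norm does not see. *)
Lemma hyp_dist_roots x y v s s' c c' : cnonneg s -> cnonneg c ->
  defect_root (star x) s s' -> defect_root x c c' ->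
  (1 - star x * y) * v = 1 -> v * (1 - star x * y) = 1 ->
  hyp_dist x y = atanh (normR (s' * (x - y) * v * c)).
Proof.
move=> s0 c0 [ssa s'sa ss' s's sE] [csa c'sa cc' c'c cE] xv vx.
rewrite starK in sE.
have [psa pE] := csqrtP s0 sE; have [qsa qE] := csqrtP c0 cE.
rewrite /hyp_dist (cinvE xv vx).
move: (csqrt (1 - x * star x)) (csqrt (1 - star x * x)) psa pE qsa qE => p q.
rewrite -sE -cE => psa pE qsa qE; congr (atanh _).
(* The inverse of p is read off from p^2 = s^2, since s is invertible. *)
have pp : p * (p * (s' * s')) = 1.
  by rewrite mulrA pE -mulrA [s * (s' * _)]mulrA ss' mul1r.
have pp' : s' * s' * p * p = 1.
  by rewrite -mulrA pE -mulrA [s' * (s * _)]mulrA s's mul1r.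
have pp2 : p * (s' * s') = s' * s' * p by rewrite -[LHS]mul1r -pp' -!mulrA pp mulr1.
rewrite (@cinvE p (p * (s' * s'))) // ?pp2 //.
have -> : s' * s' * p * (x - y) * v * q =
    s' * s' * p * s * (s' * (x - y) * v * c) * (c' * q).
  rewrite -!mulrA [c * _]mulrA cc' mul1r [s * (s' * _)]mulrA ss' mul1r.
  by [].
have iso_r : c' * q * star (c' * q) = 1.
  by rewrite star_mul qsa c'sa -mulrA [q * (q * _)]mulrA qE -mulrA cc' mulr1.
have iso_l : star (s' * s' * p * s) * (s' * s' * p * s) = 1.
  have Wsa : star (s' * s' * p) = s' * s' * p by rewrite !star_mul s'sa psa pp2.
  have WW : s' * s' * p * (s' * s' * p) = s' * s'.
    rewrite -{2}pp2 -!mulrA [p * (p * _)]mulrA pE -!mulrA [s * (s' * _)]mulrA ss'.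
    by rewrite mul1r ss' mulr1.
  move: (s' * s' * p) Wsa WW => W Wsa WW.
  by rewrite star_mul Wsa ssa -mulrA [W * (W * s)]mulrA WW -mulrA s's mulr1 ss'.
by rewrite normR_isometryr // normR_isometryl.
Qed.

Lemma atanh_le r k : 0 <= r -> r <= k -> k < 1 -> atanh r <= atanh k.
Proof.
move=> r0 rk k1; rewrite /atanh ler_wpM2r ?invr_ge0 // ler_ln ?posrE; last 2 first.
- by rewrite divr_gt0; lra.
- by rewrite divr_gt0; lra.
by rewrite ler_pdivrMr ?subr_gt0 ?(le_lt_trans rk) // mulrAC ler_pdivlMr ?subr_gt0 //; nra.
Qed.

(** The right-hand side is the hyperbolic tangent of k. *)
Lemma atanh_le_inv r k : 0 <= r -> r < 1 -> atanh r <= k ->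
  r <= (expR (2 * k) - 1) / (expR (2 * k) + 1).
Proof.
move=> r0 r1; have e0 := expR_gt0 (2 * k).
have q0 : 0 < (1 + r) / (1 - r) by rewrite divr_gt0; lra.
rewrite /atanh ler_pdivrMr // [k * 2]mulrC -(ler_expR (ln _)) lnK //.
rewrite ler_pdivrMr ?subr_gt0 // => rk.
by rewrite ler_pdivlMr; lra.
Qed.

End HypDist.

(** * Kernel bounds against hyperbolic distance and norms of values *)

Section Characters.
Variables (R : realType) (C : cstarAlgType R) (A D : set C).
Hypotheses (hA : unital_operator_algebra A) (hD : unital_cstar_subalgebra D).
Hypothesis hDA : D `<=` A.
Implicit Types (a b d u x y z : C) (Phi Psi : C -> C) (r t m k : R).

Section TwoCharacters.
Variables Phi Psi : C -> C.
Hypotheses (hPhi : D_character A D Phi) (hPsi : D_character A D Psi).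

Lemma kernel_bound_hyp_dist k a : 0 <= k -> k < 1 -> kernel_bound A Psi Phi k ->
  A a -> normR a < 1 -> hyp_dist (Phi a) (Psi a) <= atanh k.
Proof.
move=> k0 k1 hk Aa a1.
set x := Phi a; set y := Psi a.
have Dx : D x := dchar_codom hPhi Aa.
have x1 : normR x < 1 := le_lt_trans (dchar_normR hPhi Aa) a1.
have [c [c' [Dc Dc' c0 hc]]] := defect_root_exists hD Dx x1.
have [s [s' [Ds Ds' s0 hs]]] : exists s s',
    [/\ D s, D s', cnonneg s & defect_root (star x) s s'].
  by apply: (@defect_root_exists R C D) => //; [exact: (proj2 hD) | rewrite normR_star].
have [b [Ab b1 Tb]] := moebius_character hA hD hDA Dx x1 Ds' Dc hc hs Aa a1.
have [v0 _ Phib] := Tb _ hPhi.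
have [v [xv vx] Psib] := Tb _ hPsi.
rewrite (hyp_dist_roots s0 c0 hs hc xv vx) atanh_le ?normR_ge0 //.
have -> : s' * (x - y) * v * c = - Psi b by rewrite Psib -/y; ncalg; ring.
by rewrite normRN hk // Phib subrr mulr0 !mul0r.
Qed.

Lemma hyp_dist0 y : hyp_dist 0 y = atanh (normR y).
Proof.
have cn1 : cnonneg (1 : C) by exists 1; rewrite star1 mulr1.
rewrite (@hyp_dist_roots R C 0 y 1 1 1 1 1) //.
- by rewrite sub0r !mulr1 mul1r normRN.
- by split; rewrite ?star1 ?mulr1 // starK star0 mul0r subr0.
- by split; rewrite ?star1 ?mulr1 // star0 mul0r subr0.
- by rewrite star0 mul0r subr0 mulr1.
- by rewrite star0 mul0r subr0 mulr1.
Qed.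

Lemma kerdom_scale t a :
  (A `&` [set a | Phi a = 0]) a -> (A `&` [set a | Phi a = 0]) (t%:C *: a).
Proof.
move=> [Aa a0]; split; first exact: subalgZ.
by rewrite /= (dcharZ hA hD hPhi) // a0 scaler0.
Qed.

(** On the kernel of [Phi] the distance is the [atanh] of the norm of [Psi a]; the constant is tanh
    M. *)
Lemma hyp_dist_kernel_bound M :
  (forall a, A a -> normR a < 1 -> hyp_dist (Phi a) (Psi a) <= M) ->
  kernel_bound A Psi Phi ((expR (2 * M) - 1) / (expR (2 * M) + 1)).
Proof.
move=> hM a Aa a0 a1.
apply: (@normR_ball_open R C (A `&` [set a | Phi a = 0]) Psi _ _ _ _ a) => //.
- by move=> t b; apply: kerdom_scale.
- by move=> t b [Ab _]; rewrite (dcharZ hA hD hPsi).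
- move=> b [Ab b0] b1; apply: atanh_le_inv; first exact: normR_ge0.
    exact: le_lt_trans (dchar_normR hPsi Ab) b1.
  by rewrite -hyp_dist0 -b0 hM.
- by rewrite normRE lecR.
Qed.

(** Order form of |1 - u| >= 1 - |u|: the difference is (1/s - 1) (s^2 - star u * u) plus 1/s times
    the square of s - u. The division forces a separate case s = 0. *)
Lemma one_sub_sqr_lb s u : normR u <= s -> s <= 1 ->
  cnonneg (star (1 - u) * (1 - u) - ((1 - s) ^+ 2)%:C *: 1).
Proof.
move=> us s1; have s0 : 0 <= s := le_trans (normR_ge0 u) us.
have [s0'|sneq] := eqVneq s 0.
  have -> : u = 0.
    by apply: normR_eq0; apply/eqP; rewrite eq_le normR_ge0 -s0' us.
  exists 0; rewrite s0' !subr0 star1 mulr1 expr1n scale1r subrr star0 mul0r.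
  by [].
have spos : 0 < s by rewrite lt_def sneq.
have -> : star (1 - u) * (1 - u) - ((1 - s) ^+ 2)%:C *: 1 =
   (s^-1 - 1)%:C *: ((s ^+ 2)%:C *: 1 - star u * u)
   + (s^-1)%:C *: (star (s%:C *: 1 - u) * (s%:C *: 1 - u)).
  rewrite !starB starZr star1.
  have e1 : ((1 - s) ^+ 2)%:C = 1 - s%:C - s%:C + s%:C * s%:C :> R[i].
    by rewrite rmorphXn rmorphB rmorph1; ring.
  have e2 : (s^-1)%:C * s%:C = 1 :> R[i] by rewrite -rmorphM mulVf // rmorph1.
  rewrite e1 rmorphB rmorph1 rmorphXn /=.
  move: (s^-1)%:C (s%:C) e2 => q p e2.
  transitivity ((q * p * p + q * p * p - p * p) *: 1 - (q * p) *: star u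
    - (q * p) *: u + star u * u).
    by rewrite e2; ncalg; ring.
  by ncalg; ring.
apply: cnonnegD; apply: cnonnegZ.
- by rewrite subr_ge0 invf_ge1.
- by apply: cnonneg_subr_starM; rewrite ler_pXn2r ?nnegrE ?normR_ge0.
- by rewrite invr_ge0.
- exact: cnonneg_starM.
Qed.

(** With x = Phi a and y = Psi a, the defect inequality combines with [one_sub_sqr_lb] for u = star
    y * x, whose norm is at most |y|. *)
Lemma kernel_bound_norms k a : 0 <= k -> k < 1 -> kernel_bound A Phi Psi k ->
  A a -> normR a <= 1 ->
  (1 - k ^+ 2) * (1 - normR (Psi a)) ^+ 2 <= 1 - normR (Phi a) ^+ 2.
Proof.
move=> k0 k1 hk Aa a1.
set ka := 1 - k ^+ 2.
have ka0 : 0 <= ka by rewrite subr_ge0 expr_le1 // ltW.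
have ka1 : ka <= 1 by rewrite gerBl sqr_ge0.
have open b : A b -> normR b < 1 ->
    normR (Phi b) ^+ 2 <= 1 - ka * (1 - normR (Psi b)) ^+ 2.
  move=> Ab b1.
  have := kernel_bound_defect hA hD hDA hPhi hPsi k0 (ltW k1) hk Ab b1.
  rewrite /= -/ka; set x := Phi b; set y := Psi b => xpos.
  have y1 : normR y <= 1 by rewrite (le_trans (dchar_normR hPsi Ab)) // ltW.
  have x1 : normR x <= 1 by rewrite (le_trans (dchar_normR hPhi Ab)) // ltW.
  apply: cnonneg_norm_starM.
    rewrite subr_ge0 mulr_ile1 ?sqr_ge0 // expr_le1 ?subr_ge0 //.
    by rewrite gerBl normR_ge0.
  have yx : normR (star y * x) <= normR y.
    by rewrite (le_trans (normRM _ _)) // normR_star ler_piMr ?normR_ge0.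
  have := cnonnegD xpos (cnonnegZ ka0 (one_sub_sqr_lb yx y1)).
  congr (cnonneg _); move: (ka) ((1 - normR y) ^+ 2) (star (1 - star y * x)) => q t w.
  by rewrite rmorphB rmorphM rmorph1 /=; ncalg; ring.
suff : normR (Phi a) ^+ 2 <= 1 - ka * (1 - normR (Psi a)) ^+ 2 by lra.
apply: le_of_scaling; first exact: sqr_ge0.
move=> t t0 t1.
(* The left-hand side is quadratic in [a], so a factor t requires scaling [a] by its root. *)
pose q := Num.sqrt t.
have qq : q ^+ 2 = t by rewrite sqr_sqrtr // ltW.
have q0 : 0 <= q := sqrtr_ge0 t.
have q1 : q < 1 by rewrite -(@expr_lt1 _ 2) // qq.
have Aqa : A (q%:C *: a) by exact: subalgZ.
have qa1 : normR (q%:C *: a) < 1.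
  by rewrite normRZr ger0_norm // (le_lt_trans _ q1) // ler_piMr.
have := open _ Aqa qa1.
rewrite (dcharZ hA hD hPhi _ Aa) (dcharZ hA hD hPsi _ Aa) !normRZr (ger0_norm q0).
rewrite exprMn qq => /le_trans; apply.
rewrite lerD2l lerN2 ler_wpM2l //.
have y1 : normR (Psi a) <= 1 by rewrite (le_trans (dchar_normR hPsi Aa)).
have qy : q * normR (Psi a) <= normR (Psi a) by rewrite ler_piMl ?normR_ge0 // ltW.
by rewrite ler_pXn2r ?nnegrE ?subr_ge0 // ?lerD2l ?lerN2 // (le_trans qy).
Qed.

Lemma kernel_bound_cvg k (a : nat -> C) : 0 <= k -> k < 1 -> kernel_bound A Phi Psi k ->
  (forall n, A (a n) /\ `|a n| <= 1) ->
  normR (Phi (a n)) @[n --> \oo] --> (1 : R) ->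
  normR (Psi (a n)) @[n --> \oo] --> (1 : R).
Proof.
move=> k0 k1 hk ha /cvgrPdist_lt Phi1; apply/cvgrPdist_lt => e e0.
have ka0 : 0 < 1 - k ^+ 2 by rewrite subr_gt0 expr_lt1.
(* The factor 1/2 absorbs 1 - x^2 <= 2 (1 - x). *)
have d0 : 0 < (1 - k ^+ 2) * e ^+ 2 / 2 by rewrite divr_gt0 // mulr_gt0 // exprn_gt0.
have := Phi1 _ d0; apply: filterS => n.
have [Aa] := ha n; rewrite -[1]/(1%:C) ler_normR => a1.
have := kernel_bound_norms k0 k1 hk Aa a1.
have x1 := le_trans (dchar_normR hPhi Aa) a1.
have y1 := le_trans (dchar_normR hPsi Aa) a1.
move: x1 y1 (normR_ge0 (Phi (a n))) (normR_ge0 (Psi (a n))).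
move: (normR (Phi (a n))) (normR (Psi (a n))) => x y x1 y1 x0 y0 xy.
rewrite !ger0_norm ?subr_ge0 // => xe.
have : (1 - k ^+ 2) * (1 - y) ^+ 2 < (1 - k ^+ 2) * e ^+ 2 by nra.
by rewrite ltr_pM2l // ltr_pXn2r ?nnegrE ?subr_ge0 // ltW.
Qed.

(** Otherwise each bound 1 - 1 / (n + 1) is violated in the unit ball of the kernel of [Psi]; along
    these elements |Phi| tends to 1 while Psi vanishes. *)
Lemma cvg_kernel_bound :
  (forall a : nat -> C, (forall n, A (a n) /\ `|a n| <= 1) ->
     normR (Phi (a n)) @[n --> \oo] --> (1 : R) ->
     normR (Psi (a n)) @[n --> \oo] --> (1 : R)) ->
  exists k, [/\ 0 <= k, k < 1 & kernel_bound A Phi Psi k].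
Proof.
move=> hcvg; apply: contrapT => nk.
have ex n : exists a, [/\ A a, Psi a = 0, normR a <= 1 & 1 - n.+1%:R^-1 < normR (Phi a)].
  apply: contrapT => na; apply: nk; exists (1 - n.+1%:R^-1); split.
  - by rewrite subr_ge0 invf_le1 ?ler1n.
  - by rewrite ltrBlDr ltrDl invr_gt0.
  move=> a Aa a0 a1; rewrite leNgt; apply/negP => lt; apply: na; exists a.
  by split.
have [a ha] := choice ex.
have Psi1 : normR (Psi (a n)) @[n --> \oo] --> (1 : R).
  apply: hcvg => [n|]; first by have [Aa _ a1 _] := ha n; rewrite normRE lecR.
  apply/cvgrPdist_lt => e e0.
  have := near_infty_natSinv_lt (PosNum e0); apply: filterS => n /= ne.
  have [Aa _ a1 lt] := ha n.
  have x1 := le_trans (dchar_normR hPhi Aa) a1.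
  have {}ne : n.+1%:R^-1 < e := ne.
  by rewrite ger0_norm ?subr_ge0 // (lt_trans _ ne) // ltrBlDr -ltrBlDl.
have Psi0 : normR (Psi (a n)) @[n --> \oo] --> (0 : R).
  have -> : (fun n => normR (Psi (a n))) = fun=> 0.
    by apply/funext => n; have [_ -> _ _] := ha n; rewrite normR0.
  exact: cvg_cst.
have /eqP : (1 : R) = 0 by rewrite -(cvg_lim _ Psi1) ?(cvg_lim _ Psi0).
by rewrite oner_eq0.
Qed.

End TwoCharacters.
End Characters.

(** * Hilbert space representations *)

Section Inner.
Variables (R : realType) (H : hilbertType R).
Implicit Types (h k l : H) (a : R[i]).

Lemma innerDl h k l : inner (h + k) l = inner h l + inner k l.
Proof. exact: linearDl. Qed.

Lemma innerZl a h l : inner (a *: h) l = a * inner h l.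
Proof. exact: linearZl_LR. Qed.

Lemma innerC h k : inner k h = Num.conj (inner h k).
Proof. by rewrite hermitian_subproof expr0 mul1r. Qed.

Lemma innerBl h k l : inner (h - k) l = inner h l - inner k l.
Proof. by rewrite innerDl -scaleN1r innerZl mulN1r. Qed.

Lemma inner0l l : inner (0 : H) l = 0.
Proof. by rewrite -[X in inner X](subrr (0 : H)) innerBl subrr. Qed.

Lemma innerDr h k l : inner l (h + k) = inner l h + inner l k.
Proof. by rewrite !(innerC _ l) innerDl rmorphD. Qed.

Lemma innerZr a h l : inner l (a *: h) = Num.conj a * inner l h.
Proof. by rewrite !(innerC _ l) innerZl rmorphM. Qed.

Lemma innerBr h k l : inner l (h - k) = inner l h - inner l k.
Proof. by rewrite !(innerC _ l) innerBl rmorphB. Qed.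

Lemma inner0r l : inner l (0 : H) = 0.
Proof. by rewrite innerC inner0l rmorph0. Qed.

Lemma inner_sqr h : inner h h = (normR h ^+ 2)%:C.
Proof. by rewrite inner_norm normRE rmorphXn. Qed.

Lemma inner_sumr n (F : 'I_n -> H) l :
  inner l (\sum_(i < n) F i) = \sum_(i < n) inner l (F i).
Proof.
by elim/big_rec2: _ => [|i y x _ <-]; rewrite ?inner0r // innerDr.
Qed.

(** By Pythagoras no element of S is at distance less than |k| from k. *)
Lemma orthogonal_dense k (S : set H) : (forall w, S w -> inner k w = 0) ->
  closure S = setT -> k = 0.
Proof.
move=> kS Sd; apply: normR_eq0; apply/eqP/negPn/negP => k0.
have kp : 0 < normR k by rewrite lt_def k0 normR_ge0.
have Sk : closure S k by rewrite Sd.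
have [|w [Sw]] := Sk (ball k (normR k)%:C).
  by apply: nbhsx_ballx; rewrite ltcR.
rewrite -ball_normE /= ltr_normR => kw.
have kw0 := kS w Sw.
have wk0 : inner w k = 0 by rewrite innerC kw0 rmorph0.
have : (normR (k - w) ^+ 2)%:C = (normR k ^+ 2 + normR w ^+ 2)%:C :> R[i].
  by rewrite rmorphD /= -!inner_sqr innerBl !innerBr kw0 wk0 subr0 sub0r opprK.
move=> /complexI e; have := normR_ge0 w; have := normR_ge0 (k - w).
by nra.
Qed.

End Inner.

Section Representation.
Variables (R : realType) (C : cstarAlgType R) (H : hilbertType R) (D : set C).
Variable pi : C -> H -> H.
Hypotheses (hD : unital_cstar_subalgebra D) (hpi : represented_nondegenerately D pi).
Implicit Types (d e p : C) (h k : H).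

(** pi 1 h - h is orthogonal to all sums of vectors pi d k, which are dense by nondegeneracy. *)
Lemma rep1 h : pi 1 h = h.
Proof.
have D1 : D 1 by exact: (subalg1 (proj1 hD)).
apply/eqP; rewrite -subr_eq0; apply/eqP.
apply: orthogonal_dense (rep_nondegenerate hpi) => w [n [d [hs [Dd ->]]]].
rewrite inner_sumr big1 // => i _; rewrite innerBl.
have := rep_star hpi D1 h (pi (d i) (hs i)); rewrite star1 => ->.
have := rep_mul hpi D1 (Dd i); rewrite mul1r => /(congr1 (fun f => f (hs i))) /= <-.
by rewrite subrr.
Qed.

Lemma rep_starM d h : D d -> inner (pi (star d * d) h) h = (normR (pi d h) ^+ 2)%:C.
Proof.
move=> Dd; rewrite (rep_mul hpi (proj2 hD _ Dd) Dd) /= (rep_star hpi Dd) inner_sqr.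
by [].
Qed.

Lemma repB d e h : D d -> D e -> pi (d - e) h = pi d h - pi e h.
Proof.
move=> Dd De; have := rep_linear hpi (-1) De Dd.
by rewrite !scaleN1r addrC => ->; rewrite addrC.
Qed.

Lemma repZ (a : R[i]) d h : D d -> pi (a *: d) h = a *: pi d h.
Proof.
move=> Dd; have D0 : D 0 := subalg0 (proj1 hD).
have p0 k : pi 0 k = 0 by have := repB k D0 D0; rewrite subrr subrr.
have := rep_linear hpi a Dd D0; rewrite addr0 => ->.
by rewrite -[RHS]addr0 -[in RHS](p0 h).
Qed.

(** A faithful representation reflects the order. Let P be the positive part of star p * p - r; then
    P (star p * p - r) P = P^3 = np^2. The hypothesis at the vector pi P h says |pi np h|^2 <= 0, so
    np = 0 by faithfulness and P = 0. The parts and their roots must lie in [D] for [pi] to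
    apply. *)
Lemma rep_norm_bound r p : 0 <= r -> D p ->
  (forall h, normR (pi p h) ^+ 2 <= r * normR h ^+ 2) -> normR p ^+ 2 <= r.
Proof.
move=> r0 Dp hp.
have [hD1 Dstar] := hD.
pose e := star p * p.
have De : D e by apply: subalgM => //; apply: Dstar.
have D1 : D 1 := subalg1 hD1.
have Dr : D (r%:C *: 1) by exact: subalgC.
have esa : star (e - r%:C *: 1) = e - r%:C *: 1.
  by rewrite starB star_mul starK starZr star1.
have Ds : D (e - r%:C *: 1) by exact: subalgB.
have [P [Q [np [nq [[DP DQ Dnp Dnq] [Psa Qsa npsa nqsa] [PQ PQ0 QP0] [P3 Q3] PQpos]]]]] :=
  pos_neg_parts hD1 Ds esa.
have np0 : np = 0.
  apply: (rep_faithful hpi Dnp); apply/funext => h.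
  have := hp (pi P h).
  have E : inner (pi (e - r%:C *: 1) (pi P h)) (pi P h) =
      (normR (pi np h) ^+ 2)%:C.
    rewrite -(rep_star hpi DP) Psa.
    rewrite -[pi P (pi _ _)]/((pi P \o pi (e - r%:C *: 1)) (pi P h)).
    rewrite -(rep_mul hpi DP Ds) -[pi _ (pi P h)]/((pi (P * (e - r%:C *: 1)) \o pi P) h).
    rewrite -(rep_mul hpi (subalgM hD1 DP Ds) DP).
    have -> : P * (e - r%:C *: 1) * P = star np * np.
      by rewrite PQ mulrBr PQ0 subr0 P3 npsa.
    exact: rep_starM.
  move: E; rewrite repB // innerBl rep_starM // repZ // rep1 innerZl inner_sqr.
  rewrite -rmorphM -rmorphB => /complexI E.
  rewrite -subr_le0 E => n0.
  apply: normR_eq0; apply/eqP; rewrite -(@sqrf_eq0 _ (normR _)) eq_le n0 sqr_ge0.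
  by [].
have P0 : P = 0 by apply: normR_cube_eq0 => //; rewrite P3 np0 mulr0.
have : cnonneg (r%:C *: 1 - e).
  rewrite -opprB PQ P0 sub0r opprK; move: PQpos; rewrite P0 add0r.
  by move=> ?; apply/cnonneg_spos.
exact: cnonneg_norm_starM.
Qed.

End Representation.

(** * Positive functionals *)

Section PositiveFunctional.
Variables (R : realType) (C : cstarAlgType R) (f : C -> R[i]).
Hypotheses (flin : forall k x y, f (k *: x + y) = k * f x + f y).
Hypothesis fpos : forall x, cnonneg x -> 0 <= f x.

Lemma functionalD x y : f (x + y) = f x + f y.
Proof. by rewrite -[x]scale1r flin mul1r scale1r. Qed.

Lemma functional0 : f 0 = 0.
Proof. by apply: (@addrI _ (f 0)); rewrite -functionalD !addr0. Qed.

Lemma functionalZ k x : f (k *: x) = k * f x.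
Proof. by rewrite -[k *: x]addr0 flin functional0 addr0. Qed.

Lemma functionalB x y : f (x - y) = f x - f y.
Proof. by rewrite functionalD -scaleN1r functionalZ mulN1r. Qed.

Lemma functional_sa_real x : star x = x -> complex.Im (f x) = 0.
Proof.
move=> xsa.
have h1 := ger0_Im (fpos (cnonneg_subr xsa (lexx _))).
have h2 := ger0_Im (fpos (cnonneg_real C (normR_ge0 x))).
have -> : x = (normR x)%:C *: 1 - ((normR x)%:C *: 1 - x) by ncalg; ring.
by rewrite functionalB raddfB /= h1 h2 subrr.
Qed.

Lemma functional_star_Re x : complex.Re (f (star x)) = complex.Re (f x).
Proof.
have jsa : star ('i%C *: (x - star x)) = 'i%C *: (x - star x).
  rewrite starZ starB starK.
  have -> : Num.conj ('i%C : R[i]) = - 'i%C by rewrite complexiE conjCi.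
  by rewrite scaleNr -scalerN opprB.
have := functional_sa_real jsa; rewrite functionalZ functionalB.
by case: (f x) (f (star x)) => [a b] [c d] /=; lra.
Qed.

End PositiveFunctional.

(** * Harnack inequalities *)

Section Characters.
Variables (R : realType) (C : cstarAlgType R) (A D : set C).
Hypotheses (hA : unital_operator_algebra A) (hD : unital_cstar_subalgebra D).
Hypothesis hDA : D `<=` A.
Implicit Types (a b d u x y z : C) (Phi Psi : C -> C) (r t m k : R).

Lemma cnonneg_scalar r : cnonneg (r%:C *: 1 : C) -> 0 <= r.
Proof.
move=> /cnonneg_spos rpos; rewrite leNgt; apply/negP => r0.
have : normR (r%:C *: 1 : C) <= 0.
  apply: spos_norm => //; rewrite scale0r sub0r -scaleNr -rmorphN.
  by apply: spos_real; lra.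
by rewrite normRA normr_le0 lt_eqF.
Qed.

Lemma cnonneg_two_sub a : normR a <= 1 ->
  cnonneg (2%:C *: 1 - (a + star a)).
Proof.
move=> a1; apply: cnonneg_subr; first by rewrite starDE starK addrC.
by rewrite (le_trans (normRD _ _)) // normR_star -[2]/(1 + 1) lerD.
Qed.

Section TwoCharacters.
Variables Phi Psi : C -> C.
Hypotheses (hPhi : D_character A D Phi) (hPsi : D_character A D Psi).

(** Makes the value of [Phi] positive without leaving the unit ball of the kernel of [Psi]. *)
Lemma kernel_square a : A a -> Psi a = 0 -> normR a <= 1 ->
  exists b, [/\ A b, Psi b = 0, normR b <= 1 & Phi b = star (Phi a) * Phi a].
Proof.
move=> Aa a0 a1.
have Ds : D (star (Phi a)) by apply: (proj2 hD); exact: (dchar_codom hPhi).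
exists (star (Phi a) * a); split.
- by apply: subalgM => //; exact: hDA.
- by rewrite (dchar_mul hPsi (hDA Ds) Aa) a0 mulr0.
- rewrite (le_trans (normRM _ _)) // normR_star mulr_ile1 ?normR_ge0 //.
  by rewrite (le_trans (dchar_normR hPhi Aa)).
- by rewrite (dchar_mul hPhi (hDA Ds) Aa) (dchar_id hPhi Ds).
Qed.

(** With b from [kernel_square], the inequality at 1 - b reads d (1 - e) >= 1, that is |Phi a|^2 <=
    1 - 1/d. *)
Lemma harnack_kernel_bound (d : R) : 0 < d ->
  real_positive_on A (fun a => d%:C *: Phi a - Psi a) ->
  exists k, [/\ 0 <= k, k < 1 & kernel_bound A Phi Psi k].
Proof.
move=> d0 hd.
have A1 := subalg1 hA.
(* The inequality at the unit. *)
have d1 : 1 <= d.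
  have := hd 1 A1; rewrite (dchar_unit hPhi) (dchar_unit hPsi) starB starZr star1.
  have -> : d%:C *: 1 - 1 + (d%:C *: 1 - 1) = (2 * (d - 1))%:C *: (1 : C).
    by rewrite rmorphM rmorphB rmorph1; ncalg; ring.
  suff h1 : cnonneg (1 + 1 : C) by move=> /(_ h1)/cnonneg_scalar; lra.
  by apply: cnonnegD; exists 1; rewrite star1 mulr1.
have k0 : 0 <= 1 - d^-1 by rewrite subr_ge0 invf_le1.
have k1 : 1 - d^-1 < 1 by rewrite gtrBl invr_gt0.
exists (Num.sqrt (1 - d^-1)); split; first exact: sqrtr_ge0.
  by rewrite -[ltRHS]sqrtr1 ltr_sqrt.
move=> a Aa a0 a1.
have [b [Ab b0 b1 Phib]] := kernel_square Aa a0 a1.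
set e := star (Phi a) * Phi a in Phib.
have esa : star e = e by rewrite star_mul starK.
have A1b : A (1 - b) by exact: subalgB.
have b2 : cnonneg (1 - b + star (1 - b)).
  have -> : 1 - b + star (1 - b) = 2%:C *: 1 - (b + star b).
    by rewrite starB star1; ncalg; ring.
  exact: cnonneg_two_sub.
have := hd _ A1b b2.
rewrite (dcharB hA hD hPhi A1 Ab) (dcharB hA hD hPsi A1 Ab) (dchar_unit hPhi).
rewrite (dchar_unit hPsi) Phib b0 subr0 starB starZr starB star1 esa.
have d2 : 0 <= (2 * d)^-1 by rewrite invr_ge0; lra.
move=> /(cnonnegZ d2).
have -> : ((2 * d)^-1)%:C *: (d%:C *: (1 - e) - 1 + (d%:C *: (1 - e) - 1)) =
    (1 - d^-1)%:C *: 1 - e.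
  have -> : ((2 * d)^-1)%:C = 2^-1 * (d%:C)^-1 :> R[i].
    by rewrite invfM rmorphM /= !fmorphV /= rmorph_nat.
  by rewrite rmorphB rmorph1 fmorphV /=; ncalg; field; rewrite realC_neq0 ?gt_eqF.
move=> /(cnonneg_norm_starM k0) le_k.
by rewrite -(ger0_norm (normR_ge0 (Phi a))) -sqrtr_sqr ler_sqrt.
Qed.

(** The same estimate for the positive element 2 - (b + star b) of [C], taken in the vector
    functional of h; [rep_norm_bound] turns it into a norm bound. *)
Lemma cp_harnack_kernel_bound (H : hilbertType R) (pi : C -> H -> H) :
  represented_nondegenerately D pi -> cp_harnack_equivalent A pi Phi Psi ->
  exists k, [/\ 0 <= k, k < 1 & kernel_bound A Phi Psi k].
Proof.
move=> hpi [c [d [Phi' [Psi' [[c0 d0] [cpPhi cpPsi] ext _ hd]]]]].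
(* The maximum with 0 spares a proof of 1 <= d. *)
pose K := Num.max 0 (1 - d^-1).
have K0 : 0 <= K by rewrite le_max lexx.
have K1 : K < 1 by rewrite gt_max ltr01 gtrBl invr_gt0.
exists (Num.sqrt K); split; first exact: sqrtr_ge0.
  by rewrite -[ltRHS]sqrtr1 ltr_sqrt.
move=> a Aa a0 a1.
have [b [Ab b0 b1 Phib]] := kernel_square Aa a0 a1.
have Da : D (Phi a) := dchar_codom hPhi Aa.
suff le_k : normR (Phi a) ^+ 2 <= K.
  by rewrite -(ger0_norm (normR_ge0 (Phi a))) -sqrtr_sqr ler_sqrt.
apply: (rep_norm_bound hD hpi K0 Da) => h.
have functional (T : C -> H -> H) : completely_positive T ->
    (forall (k : R[i]) x y,
      inner (T (k *: x + y) h) h = k * inner (T x h) h + inner (T y h) h) /\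
    (forall x, cnonneg x -> 0 <= inner (T x h) h).
  move=> [Tlin _ Tpos]; split=> [k x y|x [y xE]].
    by rewrite (Tlin k x y) -innerZl -innerDl.
  (* Positivity is the case of 1 by 1 matrices. *)
  have hx : mx_nonneg (\matrix_(i < 1, j < 1) x).
    exists (\matrix_(i < 1, j < 1) y); apply/matrixP => i j.
    by rewrite !mxE big_ord1 !mxE xE.
  have := Tpos 1%N _ hx (fun=> h).
  by rewrite !big_ord1 mxE.
have [Philin Phipos] := functional _ cpPhi.
have [Psilin Psipos] := functional _ cpPsi.
have := hd _ (cnonneg_two_sub b1) h.
rewrite [_ h]/= -[(d%:C *: _ - _) h]/(d%:C *: _ h - _ h) innerBl innerZl.
rewrite !(functionalB Philin) !(functionalB Psilin).
rewrite !(functionalZ Philin) !(functionalZ Psilin).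
rewrite !(functionalD Philin) !(functionalD Psilin).
have [A1 D1] : A 1 /\ D 1 by split; [exact: (subalg1 hA) | exact: (subalg1 (proj1 hD))].
have [Phi1 Psi1] := ext _ A1; have [Phib' Psib'] := ext _ Ab.
have pi0 : pi 0 h = 0 by rewrite -(subrr (1 : C)) (repB hpi) // subrr.
rewrite Phi1 Psi1 Phib' Psib' (dchar_unit hPhi) (dchar_unit hPsi) b0 pi0 inner0l.
rewrite Phib (rep1 hD hpi) (rep_starM hD hpi) // !inner_sqr.
(* [star b] may lie outside [A]; positivity still ties the real parts of the values there to those
   at [b]. *)
have := functional_star_Re Philin Phipos b; rewrite Phib' Phib (rep_starM hD hpi) //=.
have := functional_star_Re Psilin Psipos b; rewrite Psib' b0 pi0 inner0l /=.
set p := inner (Phi' (star b) h) h; set q := inner (Psi' (star b) h) h => q0 pE.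
move=> pos.
have : 0 <= complex.Re (d%:C * (2%:C * (normR h ^+ 2)%:C -
   ((normR (pi (Phi a) h) ^+ 2)%:C + p)) - (2%:C * (normR h ^+ 2)%:C - (0 + q))).
  by move: pos; rewrite lecE => /andP[].
case: p pE {pos} => p1 p2 /= ->; case: q q0 => q1 q2 /= ->.
set N := normR h ^+ 2; set M := normR (pi (Phi a) h) ^+ 2 => pos.
apply: (@le_trans _ _ ((1 - d^-1) * N)); last first.
  by rewrite ler_wpM2r ?sqr_ge0 // le_max lexx orbT.
have N0 : 0 <= N by exact: sqr_ge0.
rewrite -(ler_pM2l d0).
have -> : d * ((1 - d^-1) * N) = (d - 1) * N by field; rewrite gt_eqF.
by move: pos; nra.
Qed.

End TwoCharacters.
End Characters.

(** * Harnack inequality for scalar characters *)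

Section ScalarCharacters.
Variables (R : realType) (C : cstarAlgType R) (A D : set C).
Hypotheses (hA : unital_operator_algebra A) (hD : unital_cstar_subalgebra D).
Hypothesis hDA : D `<=` A.
Implicit Types (a b d u x y z : C) (Phi Psi : C -> C) (r t m k e p : R).

Lemma one_dimensional_scalar d : one_dimensional D -> D d -> exists f : R[i], d = f *: 1.
Proof.
move=> [v v0 DE] Dd.
have : D 1 by exact: (subalg1 (proj1 hD)).
rewrite DE => -[k0 _ k01]; move: Dd; rewrite DE => -[f _ <-].
have k00 : k0 != 0.
  by apply/eqP => k00; move: k01; rewrite k00 scale0r => /esym/eqP; rewrite oner_eq0.
by exists (f / k0); rewrite -k01 scalerA divfK.
Qed.

(** The defect of the Cayley transform is 2 e star u * (a + star a) * u. *)
Lemma cayley_contraction e a u : 0 <= e -> cnonneg (a + star a) ->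
  (1 + e%:C *: a) * u = 1 -> normR ((1 - e%:C *: a) * u) <= 1.
Proof.
move=> e0 apos au; apply: contraction_of_defect.
have au' : star u * (1 + e%:C *: star a) = 1.
  by have := congr1 (@star R C) au; rewrite star_mul starDE star1 starZr.
have one : 1 = (star u * (1 + e%:C *: star a)) * ((1 + e%:C *: a) * u).
  by rewrite au' au mulr1.
have -> : 1 - star ((1 - e%:C *: a) * u) * ((1 - e%:C *: a) * u) =
    (2 * e)%:C *: (star u * (a + star a) * u).
  rewrite star_mul starB starZr star1 [X in X - _]one.
  by rewrite rmorphM /=; ncalg; ring.
by apply: cnonnegZ; [rewrite mulr_ge0 | exact: cnonneg_conj].
Qed.

(** A small e makes the inverse of 1 + e a a Neumann series, hence an element of [A]. Positive
    scaling does no harm to homogeneous inequalities. *)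
Lemma accretive_resolvent a : A a -> exists e u,
  [/\ 0 < e, A u & (1 + e%:C *: a) * u = 1].
Proof.
move=> Aa; pose e := (normR a + 1)^-1.
have n0 : 0 < normR a + 1 by rewrite ltr_wpDl ?normR_ge0.
have e0 : 0 < e by rewrite invr_gt0.
have Aea : A (- (e%:C *: a)) by apply: subalgN => //; exact: subalgZ.
have ea1 : normR (- (e%:C *: a)) < 1.
  by rewrite normRN normRZr ger0_norm ?(ltW e0) // ltr_pdivrMl // mulr1 ltrDl.
have [u [Au au _ _]] := neumann hA Aea ea1.
by exists e, u; split => //; move: au; rewrite opprK.
Qed.

Lemma normR_scalar (f : R[i]) : normR (f *: 1 : C) = complex.Re `|f|.
Proof. by rewrite normRZ normR1 mulr1. Qed.

Lemma Re_norm_sqr (f : R[i]) :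
  (complex.Re `|f|) ^+ 2 = complex.Re f ^+ 2 + complex.Im f ^+ 2.
Proof. by rewrite normc_def /= sqr_sqrtr // addr_ge0 // sqr_ge0. Qed.

Lemma Re_norm_ge0 (f : R[i]) : 0 <= complex.Re `|f|.
Proof. by rewrite -ler0c RRe_real ?ger0_real. Qed.

Lemma scaler_one_inj (f g : R[i]) : f *: (1 : C) = g *: 1 -> f = g.
Proof.
move=> /eqP; rewrite -subr_eq0 -scalerBl scaler_eq0 oner_eq0 orbF subr_eq0.
by move=> /eqP.
Qed.

Section OneCharacter.
Variable Phi : C -> C.
Hypothesis hPhi : D_character A D Phi.

Lemma dchar_cayley e a u (f : R[i]) : A a -> A u -> (1 + e%:C *: a) * u = 1 ->
  Phi a = f *: 1 -> 1 + e%:C * f != 0 /\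
  Phi ((1 - e%:C *: a) * u) = ((1 - e%:C * f) / (1 + e%:C * f)) *: 1.
Proof.
move=> Aa Au au Phia.
have A1 := subalg1 hA.
have Aea : A (e%:C *: a) by exact: subalgZ.
have := congr1 Phi au.
rewrite (dchar_mul hPhi (subalgD hA A1 Aea) Au) (dcharD hPhi A1 Aea).
rewrite (dcharZ hA hD hPhi _ Aa) (dchar_unit hPhi) Phia => su.
have {}su : (1 + e%:C * f) *: Phi u = 1 by rewrite -su; ncalg; ring.
have s0 : 1 + e%:C * f != 0.
  by apply/eqP => s0; move: su; rewrite s0 scale0r => /esym/eqP; rewrite oner_eq0.
split => //.
rewrite (dchar_mul hPhi (subalgB hA A1 Aea) Au) (dcharB hA hD hPhi A1 Aea).
rewrite (dcharZ hA hD hPhi _ Aa) (dchar_unit hPhi) Phia.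
have -> : ((1 - e%:C * f) / (1 + e%:C * f)) *: 1 = (1 - e%:C * f) *: Phi u.
  by rewrite -su scalerA divfK.
by ncalg; ring.
Qed.

(** The Cayley transform is a contraction in [A], and |1 - e f| <= |1 + e f| means Re f >= 0. *)
Lemma accretive_Re_ge0 a (f : R[i]) : A a -> cnonneg (a + star a) -> Phi a = f *: 1 ->
  0 <= complex.Re f.
Proof.
move=> Aa apos Phia.
have [e [u [e0 Au au]]] := accretive_resolvent Aa.
have A1 := subalg1 hA.
have Aea : A (e%:C *: a) by exact: subalgZ.
have b1 := cayley_contraction (ltW e0) apos au.
have [s0 PhiE] := dchar_cayley Aa Au au Phia.
have := dchar_normR hPhi (subalgM hA (subalgB hA A1 Aea) Au).
move=> /le_trans/(_ b1); rewrite PhiE => n1.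
have : normR ((1 - e%:C * f) *: 1 : C) <= complex.Re `|1 + e%:C * f|.
  have -> : (1 - e%:C * f) *: (1 : C) =
      (1 + e%:C * f) *: (((1 - e%:C * f) / (1 + e%:C * f)) *: 1).
    by rewrite scalerA mulrCA divff // mulr1.
  by rewrite normRZ ler_piMr ?Re_norm_ge0.
rewrite normR_scalar -(@ler_pXn2r _ 2) ?nnegrE ?Re_norm_ge0 // !Re_norm_sqr.
case: f {Phia PhiE n1 s0} => f1 f2 /=; rewrite !mul0r !(subr0, addr0, add0r, sub0r).
by rewrite sqrrN lerD2r -(pmulr_rge0 _ e0) => h; nra.
Qed.

End OneCharacter.

Section TwoCharacters.
Variables Phi Psi : C -> C.
Hypotheses (hPhi : D_character A D Phi) (hPsi : D_character A D Psi).

(** The Cayley transform b has Psi b = r; its Moebius transform centred at r lies in the kernel of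
    [Psi], and [Phi] takes there the value (p - f) / (p + f). Squaring |p - f| <= k |p + f| and
    dropping the squares of p and Im f gives the constant. *)
Lemma kernel_bound_harnack_normalized k a (f : R[i]) p :
  0 <= k -> k < 1 -> kernel_bound A Phi Psi k ->
  A a -> cnonneg (a + star a) -> 0 < p -> Phi a = f *: 1 -> Psi a = p%:C *: 1 ->
  complex.Re f <= 2 * (1 + k ^+ 2) / (1 - k ^+ 2) * p.
Proof.
move=> k0 k1 hk Aa apos p0 Phia Psia.
have [e [u [e0 Au au]]] := accretive_resolvent Aa.
have A1 := subalg1 hA.
have Aea : A (e%:C *: a) by exact: subalgZ.
pose b := (1 - e%:C *: a) * u.
have b1 : normR b <= 1 := cayley_contraction (ltW e0) apos au.
have Ab : A b := subalgM hA (subalgB hA A1 Aea) Au.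
have [s0 Phib] := dchar_cayley hPhi Aa Au au Phia.
have [t0 Psib] := dchar_cayley hPsi Aa Au au Psia.
rewrite -/b in Phib Psib.
pose r := (1 - e * p) / (1 + e * p).
have ep0 : 0 < e * p by rewrite mulr_gt0.
have tr0 : 0 < 1 + e * p by lra.
have r1 : r < 1 by rewrite ltr_pdivrMr //; lra.
have rN1 : -1 < r by rewrite ltr_pdivlMr //; lra.
have rE : r%:C = (1 - e%:C * p%:C) / (1 + e%:C * p%:C).
  by rewrite /r !rmorphM fmorphV /= rmorphB rmorphD rmorphM rmorph1.
rewrite -rE in Psib.
have Arb : A (r%:C *: b) by exact: subalgZ.
have rb1 : normR (r%:C *: b) < 1.
  rewrite normRZr (@le_lt_trans _ _ `|r|) ?ler_piMr //.
  by rewrite ltr_norml rN1.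
have [w [Aw bw _ _]] := neumann hA Arb rb1.
have Ar : A (r%:C *: 1) by exact: subalgC.
have Abr : A (b - r%:C *: 1) by exact: subalgB.
have m1 := scalar_moebius_contraction rN1 r1 b1 bw.
have Psim : Psi ((b - r%:C *: 1) * w) = 0.
  rewrite (dchar_mul hPsi Abr Aw) (dcharB hA hD hPsi Ab Ar) Psib.
  by rewrite (dcharZ hA hD hPsi _ A1) (dchar_unit hPsi) subrr mul0r.
have := hk _ (subalgM hA Abr Aw) Psim m1.
rewrite (dchar_mul hPhi Abr Aw) (dcharB hA hD hPhi Ab Ar) Phib.
rewrite (dcharZ hA hD hPhi _ A1) (dchar_unit hPhi).
have := dchar_oneB hA hD hPhi Arb Aw bw.
rewrite (dcharZ hA hD hPhi _ Ab) Phib rE.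
set beta := (1 - e%:C * f) / _; set rho := (1 - _) / _ => wE.
have {}wE : (1 - rho * beta) *: Phi w = 1 by rewrite -wE; ncalg; ring.
have -> : (beta *: 1 - rho *: 1) * Phi w = (beta - rho) *: Phi w by ncalg; ring.
pose q := 2 * e%:C / ((1 + e%:C * f) * (1 + e%:C * p%:C)).
have q0 : q != 0.
  rewrite mulf_neq0 ?invr_neq0 ?mulf_neq0 ?pnatr_eq0 //.
  by rewrite realC_neq0 // gt_eqF.
have e1 : beta - rho = q * (p%:C - f) by rewrite /beta /rho /q; field; rewrite s0 t0.
have e2 : 1 - rho * beta = q * (p%:C + f) by rewrite /beta /rho /q; field; rewrite s0 t0.
rewrite e1 e2 in wE *.
have main : (p%:C + f) *: ((q * (p%:C - f)) *: Phi w) = (p%:C - f) *: 1.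
  by rewrite -wE; ncalg; ring.
move=> nk.
have : complex.Re `|p%:C - f| <= complex.Re `|p%:C + f| * k.
  rewrite -normR_scalar -main normRZ ler_wpM2l ?Re_norm_ge0 //.
have kp : 0 <= complex.Re `|p%:C + f| * k by rewrite mulr_ge0 ?Re_norm_ge0.
rewrite -(@ler_pXn2r _ 2) ?nnegrE ?Re_norm_ge0 // exprMn !Re_norm_sqr.
have q1 : k ^+ 2 < 1 by rewrite expr_lt1.
have q00 : 0 <= k ^+ 2 by exact: sqr_ge0.
move: (k ^+ 2) q1 q00 => k2 q1 q00.
case: f {Phia Phib s0 beta wE q q0 e1 e2 main nk kp} => f1 f2 /=.
rewrite !(sub0r, add0r) => h.
have d0 : 0 < 1 - k2 by lra.
rewrite mulrAC ler_pdivlMr //.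
have [f10|f10] := leP f1 0; first by nra.
rewrite -(ler_pM2l f10); nra.
Qed.

Lemma kernel_bound_harnack k : 0 <= k -> k < 1 -> kernel_bound A Phi Psi k ->
  forall a (f g : R[i]), A a -> cnonneg (a + star a) ->
    Phi a = f *: 1 -> Psi a = g *: 1 ->
  complex.Re f <= 2 * (1 + k ^+ 2) / (1 - k ^+ 2) * complex.Re g.
Proof.
move=> k0 k1 hk a f g Aa apos Phia Psia.
set K := 2 * (1 + k ^+ 2) / (1 - k ^+ 2).
have K0 : 0 < K.
  rewrite divr_gt0 ?subr_gt0 ?expr_lt1 // mulr_gt0 //.
  by rewrite ltr_pwDl // sqr_ge0.
have g0 : 0 <= complex.Re g := accretive_Re_ge0 hPsi Aa apos Psia.
apply/ler_addgt0Pr => e e0.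
pose t := e / K.
have t0 : 0 < t by rewrite divr_gt0.
(* Adding [l] makes the value of [Psi] real and positive, at the cost K t = e. *)
pose l : R[i] := t%:C - 'i%C * (complex.Im g)%:C.
have A1 := subalg1 hA.
have Al : A (l *: 1) by exact: subalgC.
have PhiE : Phi (a + l *: 1) = (f + l) *: 1.
  rewrite (dcharD hPhi Aa Al) (dcharZ hA hD hPhi _ A1) (dchar_unit hPhi) Phia.
  by rewrite -scalerDl.
have PsiE : Psi (a + l *: 1) = (complex.Re g + t)%:C *: 1.
  rewrite (dcharD hPsi Aa Al) (dcharZ hA hD hPsi _ A1) (dchar_unit hPsi) Psia.
  rewrite -scalerDl; congr (_ *: _); rewrite [in LHS](complexE g) /l rmorphD /=.
  ring.
have alpos : cnonneg (a + l *: 1 + star (a + l *: 1)).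
  have -> : a + l *: 1 + star (a + l *: 1) = (a + star a) + (2 * t)%:C *: 1.
    rewrite starDE starZ star1.
    have -> : (2 * t)%:C = l + Num.conj l.
      have -> : Num.conj l = t%:C + 'i%C * (complex.Im g)%:C.
        rewrite /l complexiE rmorphB /= conj_realC.
        rewrite [Num.conj (_ * _)]rmorphM /= conj_realC.
        by rewrite conjCi mulNr opprK.
      by rewrite /l rmorphM /= rmorph_nat; ring.
    by ncalg; ring.
  by apply: cnonnegD => //; apply: cnonneg_real; rewrite mulr_ge0 // ltW.
have gt0 : 0 < complex.Re g + t by rewrite ltr_wpDl.
have := kernel_bound_harnack_normalized k0 k1 hk (subalgD hA Aa Al) alpos gt0 PhiE PsiE.
have Rl (z : R[i]) : complex.Re (z + l) = complex.Re z + t.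
  by case: z => z1 z2; rewrite /l /=; ring.
rewrite -/K Rl mulrDr.
have -> : K * t = e by rewrite /t mulrC divfK // gt_eqF.
by move: (K * _) => z; lra.
Qed.

End TwoCharacters.
End ScalarCharacters.

(** * Extension of positive functionals *)

Section HahnBanach.
Variables (R : realType) (V : lmodType R[i]) (p : V -> R).
Hypothesis pD : forall x y, p (x + y) <= p x + p y.
Hypothesis pZ : forall (t : R) x, 0 < t -> p (t%:C *: x) = t * p x.
Implicit Types (x y z : V) (r s t : R) (G : set (V * R)).

(* Partial real-linear functionals are represented by their graphs; domination by
   [p] makes the graph functional. *)
Definition dominated_graph G : Prop :=
  (forall x y r s t, G (x, r) -> G (y, s) -> G (t%:C *: x + y, t * r + s)) /\
  (forall x r, G (x, r) -> r <= p x).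

Section Graph.
Variable G : set (V * R).
Hypotheses (hG : dominated_graph G) (G_neq0 : G !=set0).

Lemma dominated_graphZ x r t : G (x, r) -> G (t%:C *: x, t * r).
Proof.
move=> Gx; have [Glin _] := hG.
have G0 : G (0, 0).
  have := Glin x x r r (-1) Gx Gx.
  by rewrite rmorphN rmorph1 scaleN1r mulN1r !addNr.
by have := Glin _ _ _ _ t Gx G0; rewrite !addr0.
Qed.

Lemma dominated_graph_fun x r s : G (x, r) -> G (x, s) -> r = s.
Proof.
move=> Gr Gs; have [Glin Gp] := hG.
have G0 d : G (0, d) -> d <= 0.
  move=> Gd; rewrite leNgt; apply/negP => d0.
  have p0 : p 0 = 2 * p 0 by rewrite -[in LHS](scaler0 V (2%:C)) pZ.
  by have := Gp _ _ Gd; lra.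
have h1 := Glin _ _ _ _ (-1) Gr Gs; have h2 := Glin _ _ _ _ (-1) Gs Gr.
move: h1 h2; rewrite rmorphN rmorph1 scaleN1r !mulN1r !addNr => /G0 h1 /G0 h2.
lra.
Qed.

(** The value at x0 must lie above all r - p (y - x0) and below all p (y + x0) - r with (y, r) in G;
    subadditivity makes this possible, and the supremum of the lower bounds is taken. *)
Lemma dominated_graph_extend x0 : exists G', [/\ dominated_graph G', G `<=` G' &
  exists r, G' (x0, r)].
Proof.
have [Glin Gp] := hG; have [[y0 r0] G0] := G_neq0.
pose L := [set l | exists y r, G (y, r) /\ l = r - p (y - x0)].
have LU y r l : G (y, r) -> L l -> l <= p (y + x0) - r.
  move=> Gy [z [s [Gz ->]]]; rewrite lerBlDr addrAC lerBrDr.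
  have := Glin _ _ _ _ 1 Gz Gy; rewrite rmorph1 scale1r mul1r => /Gp.
  move=> /le_trans; apply.
  have -> : z + y = (y + x0) + (z - x0) by rewrite addrACA subrr addr0 addrC.
  exact: pD.
have L_sup : has_sup L.
  split; first by exists (r0 - p (y0 - x0)), y0, r0.
  by exists (p (y0 + x0) - r0) => l; apply: LU.
pose al := sup L.
have al_lb y r : G (y, r) -> r - p (y - x0) <= al.
  by move=> Gy; apply: sup_upper_bound => //; exists y, r.
have al_ub y r : G (y, r) -> al <= p (y + x0) - r.
  by move=> Gy; apply: sup_le_ub; [case: L_sup | move=> l; apply: LU].
exists [set z | exists y r t, G (y, r) /\ z = (y + t%:C *: x0, r + t * al)].
split.
- split.
    move=> x y r s t [x' [r' [t1 [Gx [-> ->]]]]] [y' [s' [t2 [Gy [-> ->]]]]].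
    exists (t%:C *: x' + y'), (t * r' + s'), (t * t1 + t2); split; first exact: Glin.
    congr (_, _); last by ring.
    by rewrite rmorphD rmorphM scalerDl scalerDr scalerA addrACA.
  move=> x r [y [s [t [Gy [-> ->]]]]].
  have [t0|t0|->] := ltgtP t 0; last first.
  + by rewrite scale0r mul0r !addr0; exact: Gp.
  + have tV : t^-1 * s <= p ((t^-1)%:C *: y + x0) - al.
      by have := al_ub _ _ (dominated_graphZ t^-1 Gy); lra.
    have -> : y + t%:C *: x0 = t%:C *: ((t^-1)%:C *: y + x0).
      by rewrite scalerDr scalerA -rmorphM divff ?gt_eqF // scale1r.
    rewrite pZ // -lerBrDr -mulrBr -ler_pdivrMl //.
  + have nt0 : 0 < - t by rewrite oppr_gt0.
    have tV : (- t)^-1 * s - p (((- t)^-1)%:C *: y - x0) <= al.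
      exact: al_lb _ _ (dominated_graphZ (- t)^-1 Gy).
    have -> : y + t%:C *: x0 = (- t)%:C *: (((- t)^-1)%:C *: y - x0).
      rewrite scalerBr scalerA -rmorphM divff ?gt_eqF // scale1r.
      by rewrite rmorphN scaleNr opprK.
    rewrite pZ //; move: (p _) tV => z tV.
    have : s <= - t * (al + z) by rewrite -ler_pdivrMl //; lra.
    by rewrite mulrDr !mulNr; lra.
- by move=> [y r] Gy; exists y, r, 0; rewrite scale0r mul0r !addr0.
exists (0 * r0 + al), (0%:C *: y0), (0 * r0), 1; split.
  exact: dominated_graphZ.
by rewrite scale0r rmorph1 scale1r mul1r add0r.
Qed.

End Graph.

Theorem hahn_banach G : dominated_graph G -> G !=set0 ->
  exists F : V -> R, [/\ forall x r, G (x, r) -> F x = r,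
    forall t x y, F (t%:C *: x + y) = t * F x + F y & forall x, F x <= p x].
Proof.
move=> hG G0.
pose P (X : set (V * R)) := X = set0 \/ (dominated_graph X /\ G `<=` X).
have [F FP tot|M [MP Mmax]] := @Zorn_bigcup _ P.
  have [->|/set0P[z [X FX Xz]]] := eqVneq (\bigcup_(X in F) X) set0; first by left.
  have good Y (y : V * R) : F Y -> Y y -> dominated_graph Y /\ G `<=` Y.
    by move=> FY Yy; have [Y0|//] := FP Y FY; rewrite Y0 in Yy.
  right; split; last first.
    by move=> w Gw; exists X => //; exact: (proj2 (good X z FX Xz)).
  split=> [x y r s t [Y FY Yx] [Z FZ Zy]|x r [Y FY Yx]]; last first.
    exact: (proj2 (proj1 (good Y _ FY Yx))).
  have [YZ|ZY] := tot _ _ FY FZ.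
    by exists Z => //; apply: (proj1 (proj1 (good Z _ FZ Zy))) => //; exact: YZ.
  by exists Y => //; apply: (proj1 (proj1 (good Y _ FY Yx))) => //; exact: ZY.
case: MP => [M0|[hM GM]].
  exfalso; apply: (Mmax G); last by right; split.
  by rewrite M0; split; [by move=> ? [] | move=> sG; case: G0 => z /sG].
have M0 : M !=set0 by case: G0 => z /GM; exists z.
have Mtotal x : exists r, M (x, r).
  have [M' [hM' MM' [r M'x]]] := dominated_graph_extend hM M0 x.
  exists r; apply: contrapT => nMx; apply: (Mmax M').
    by split => // M'M; exact/nMx/M'M.
  by right; split => //; exact: subset_trans MM'.
have [F FM] := choice Mtotal.
exists F; split => [x r Gx|t x y|x].
- exact: (dominated_graph_fun hM (FM x) (GM _ Gx)).
- apply: (dominated_graph_fun hM (FM _)).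
  by apply: (proj1 hM).
- exact: (proj2 hM).
Qed.

End HahnBanach.

Section PositiveExtension.
Variables (R : realType) (C : cstarAlgType R) (A : set C) (tau : C -> R[i]).
Hypothesis hA : unital_operator_algebra A.
Hypothesis tau_lin : forall (k : R[i]) a b, A a -> A b ->
  tau (k *: a + b) = k * tau a + tau b.
Hypothesis tau_pos : forall a, A a -> cnonneg (a + star a) -> 0 <= complex.Re (tau a).
Implicit Types (a b x y : C) (r s t : R).

(** |a| 1 - a has positive real part. *)
Lemma accretive_functional_bound a : A a ->
  complex.Re (tau a) <= complex.Re (tau 1) * normR a.
Proof.
move=> Aa; have A1 := subalg1 hA.
have Aa' : A (- a) by exact: subalgN.
have A0 := subalg0 hA.
have tau0 : tau 0 = 0.
  by have := tau_lin (-1) A0 A0; rewrite scaler0 addr0 mulN1r addNr.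
have tauN : tau (- a) = - tau a.
  by have := tau_lin (-1) Aa A0; rewrite !addr0 scaleN1r tau0 addr0 mulN1r.
have := tau_pos (subalg_lin (normR a)%:C hA A1 Aa').
rewrite tau_lin // tauN => h.
have : cnonneg ((normR a)%:C *: 1 - a + star ((normR a)%:C *: 1 - a)).
  have ra : cnonneg ((2 * normR a)%:C *: 1 - (a + star a)).
    apply: cnonneg_subr; first by rewrite starDE starK addrC.
    by rewrite (le_trans (normRD _ _)) // normR_star mulr_natl mulr2n.
  move: ra; congr (cnonneg _).
  by rewrite starB starZr star1 rmorphM /=; ncalg; ring.
move=> /h; case: (tau 1) (tau a) => [u v] [u' v'] /=.
by rewrite mul0r subr0 subr_ge0 mulrC.
Qed.

(** Re tau is extended to a real-linear F below M |x|, with equality at 1, and f x = F x - 'i F ('i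
    x). Attaining the bound at 1 forces positivity: | |x| - x | <= |x| gives F x >= 0 for positive
    x, and F ('i x) = 0 for selfadjoint x. *)
Theorem positive_extension : exists f : C -> R[i],
  [/\ forall (k : R[i]) x y, f (k *: x + y) = k * f x + f y,
      forall a, A a -> f a = tau a & forall x, cnonneg x -> 0 <= f x].
Proof.
have A1 := subalg1 hA; have A0 := subalg0 hA.
have tau0 : tau 0 = 0.
  by have := tau_lin (-1) A0 A0; rewrite scaler0 addr0 mulN1r addNr.
have tauZ k a : A a -> tau (k *: a) = k * tau a.
  by move=> Aa; have := tau_lin k Aa A0; rewrite !addr0 tau0 addr0.
pose M := complex.Re (tau 1).
have M0 : 0 <= M.
  apply: tau_pos => //; rewrite star1; apply: cnonnegD; exists 1;
  by rewrite star1 mulr1.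
pose p (x : C) := M * normR x.
have pD x y : p (x + y) <= p x + p y by rewrite /p -mulrDr ler_wpM2l // normRD.
have pZ t x : 0 < t -> p (t%:C *: x) = t * p x.
  by move=> t0; rewrite /p normRZr gtr0_norm // mulrCA.
pose G : set (C * R) := [set z | A z.1 /\ z.2 = complex.Re (tau z.1)].
have hG : dominated_graph p G.
  split=> [x y r s t [/= Ax ->] [/= Ay ->]|x r [/= Ax ->]]; last first.
    exact: accretive_functional_bound.
  split=> /=; first exact: subalg_lin.
  rewrite tau_lin //; case: (tau x) (tau y) => [u v] [u' v'] /=.
  by rewrite mul0r subr0.
have G0 : G !=set0 by exists (1, complex.Re (tau 1)).
have [F [FG Flin Fp]] := hahn_banach pD pZ hG G0.
have FA a : A a -> F a = complex.Re (tau a) by move=> Aa; apply: FG; split.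
have F0 : F 0 = 0 by rewrite FA // tau0.
have FZ t x : F (t%:C *: x) = t * F x by rewrite -[_ *: x]addr0 Flin F0 addr0.
have FD x y : F (x + y) = F x + F y.
  by have := Flin 1 x y; rewrite rmorph1 scale1r mul1r.
have FN x : F (- x) = - F x.
  by have := FZ (-1) x; rewrite rmorphN rmorph1 scaleN1r mulN1r.
have Fsa x : star x = x -> F ('i%C *: x) = 0.
  have half (y : C) : star y = y -> F ('i%C *: y) <= 0.
    move=> ysa; rewrite leNgt; apply/negP => Fy0.
    (* |1 + 'i t y|^2 = |1 + t^2 y^2| exceeds 1 only to second order in t, whereas F grows to first
       order. *)
    have Fty t : 0 < t -> F ('i%C *: y) <= M * normR y ^+ 2 * t.
      move=> t0.
      have sq : normR (1 + t%:C *: ('i%C *: y)) ^+ 2 <= 1 + (t * normR y) ^+ 2.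
        rewrite -normR_starM.
        have -> : star (1 + t%:C *: ('i%C *: y)) * (1 + t%:C *: ('i%C *: y)) =
            1 + (t ^+ 2)%:C *: (y * y).
          rewrite starDE star1 starZr starZ ysa.
          have -> : Num.conj ('i%C : R[i]) = - 'i%C by rewrite complexiE conjCi.
          rewrite rmorphXn /=.
          have ii : 'i%C * 'i%C = -1 :> R[i] by rewrite -expr2 sqr_i.
          transitivity (1 - (t%:C ^+ 2 * ('i%C * 'i%C)) *: (y * y)).
            by ncalg; ring.
          by rewrite ii mulrN1 scaleNr opprK.
        rewrite (le_trans (normRD _ _)) // normR1 lerD2l normRZr.
        by rewrite ger0_norm ?sqr_ge0 // normR_sqr // exprMn.
      have n1 : normR (1 + t%:C *: ('i%C *: y)) <= 1 + (t * normR y) ^+ 2.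
        by move: sq (normR_ge0 (1 + t%:C *: ('i%C *: y))) (sqr_ge0 (t * normR y)); nra.
      have := Fp (1 + t%:C *: ('i%C *: y)); rewrite FD FZ FA // -/M /p => h.
      have := le_trans h (ler_wpM2l M0 n1).
      rewrite mulrDr mulr1 lerD2l exprMn => h2.
      rewrite -(ler_pM2l t0); apply: le_trans h2 _.
      by rewrite le_eqVlt; apply/orP; left; apply/eqP; ring.
    pose N := M * normR y ^+ 2 + 1.
    have N0 : 0 < N by rewrite ltr_wpDl // mulr_ge0 // sqr_ge0.
    have t0 : 0 < F ('i%C *: y) / (2 * N) by rewrite divr_gt0 // mulr_gt0.
    have := Fty _ t0; apply/negP; rewrite -ltNge.
    apply: (@le_lt_trans _ _ (N * (F ('i%C *: y) / (2 * N)))).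
      by rewrite ler_wpM2r ?(ltW t0) // /N lerDl.
    have -> : N * (F ('i%C *: y) / (2 * N)) = F ('i%C *: y) / 2.
      by field; rewrite gt_eqF.
    by rewrite ltr_pdivrMr //; lra.
  move=> xsa; apply/eqP; rewrite eq_le half //=.
  have := half (- x); rewrite starN xsa scalerN FN oppr_le0; exact.
have Fpos x : cnonneg x -> 0 <= F x.
  move=> xpos.
  have xsa := cnonneg_sa xpos.
  have n1 : normR ((normR x)%:C *: 1 - x) <= normR x.
    apply: cnonneg_norm; first exact: normR_ge0.
      by apply: cnonneg_subr.
    by rewrite opprB addrCA subrr addr0.
  have := Fp ((normR x)%:C *: 1 - x); rewrite FD FN FZ FA // -/M /p => h.
  have := le_trans h (ler_wpM2l M0 n1); rewrite mulrC; lra.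
exists (fun x => F x +i* (- F ('i%C *: x))); split.
- move=> [s t] x y.
  have kx (z : C) : (s +i* t) *: z = s%:C *: z + t%:C *: ('i%C *: z).
    rewrite scalerA -scalerDl; congr (_ *: _).
    by apply/eqP; rewrite eq_complex /=; apply/andP; split; apply/eqP; ring.
  have ikx : 'i%C *: ((s +i* t) *: x + y) = s%:C *: ('i%C *: x) - t%:C *: x + 'i%C *: y.
    rewrite scalerDr kx scalerDr !scalerA; congr (_ + _); congr (_ + _).
      by rewrite mulrC.
    rewrite -scaleNr; congr (_ *: _).
    by apply/eqP; rewrite eq_complex /=; apply/andP; split; apply/eqP; ring.
  rewrite ikx kx !FD FN !FZ; apply/eqP; rewrite eq_complex /=.
  by apply/andP; split; apply/eqP; ring.
- move=> a Aa; have Aia : A ('i%C *: a) by exact: subalgZ.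
  rewrite !FA // tauZ //; case: (tau a) => u v; apply/eqP.
  by rewrite eq_complex /=; apply/andP; split; apply/eqP; ring.
- move=> x xpos; rewrite Fsa ?oppr0; last exact: cnonneg_sa.
  by rewrite lecE /= eqxx Fpos.
Qed.

End PositiveExtension.

(** * Complete positivity of scalar maps *)

Section ScalarCompletelyPositive.
Variables (R : realType) (C : cstarAlgType R) (H : hilbertType R) (f : C -> R[i]).
Hypotheses (flin : forall k x y, f (k *: x + y) = k * f x + f y).
Hypothesis fpos : forall x, cnonneg x -> 0 <= f x.

Lemma functional_sum n (F : 'I_n -> C) : f (\sum_(i < n) F i) = \sum_(i < n) f (F i).
Proof.
elim/big_rec2: _ => [|i y x _ <-]; first exact: functional0.
exact: functionalD.
Qed.

Lemma star_sum n (F : 'I_n -> C) : star (\sum_(i < n) F i) = \sum_(i < n) star (F i).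
Proof.
by elim/big_rec2: _ => [|i y x _ <-]; [exact: star0 | exact: starD].
Qed.

(* Gram-Schmidt on the first vector. *)
Lemma gram_pairing_ge0 n (y : 'I_n -> C) (h : 'I_n -> H) :
  0 <= \sum_(i < n) \sum_(j < n) f (star (y i) * y j) * inner (h j) (h i).
Proof.
elim: n y h => [|n ih] y h; first by rewrite big_ord0.
have ih0 (g : 'I_n.+1 -> H) : g ord0 = 0 ->
    0 <= \sum_(i < n.+1) \sum_(j < n.+1) f (star (y i) * y j) * inner (g j) (g i).
  move=> g0; rewrite big_ord_recl big1 ?add0r => [|j _]; last first.
    by rewrite g0 inner0r mulr0.
  have := ih (y \o lift ord0) (g \o lift ord0); congr (_ <= _).
  apply: eq_bigr => i _; rewrite big_ord_recl g0 inner0l mulr0 add0r.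
  by [].
have [h0|h0] := eqVneq (h ord0) 0; first exact: ih0.
have nz : normR (h ord0) != 0 by apply: contra h0 => /eqP/normR_eq0/eqP.
have [u [uu hu]] : exists u : H, inner u u = 1 /\ inner (h ord0) u *: u = h ord0.
  exists (((normR (h ord0))^-1)%:C *: h ord0).
  rewrite !(innerZl, innerZr) conj_realC inner_sqr -!rmorphM scalerA -!rmorphM.
  rewrite expr2 mulKf // mulVf // rmorph1; split => //.
  by rewrite divff // scale1r.
pose c j := inner (h j) u.
pose g j := h j - c j *: u.
have gE i j : inner (h j) (h i) = c j * Num.conj (c i) + inner (g j) (g i).
  rewrite /g innerBl !innerBr !innerZl !innerZr uu -/(c j) (innerC (h i) u).
  by rewrite -/(c i) mulr1; ring.
have g0 : g ord0 = 0 by rewrite /g hu subrr.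
(* The components along u contribute f (star Y * Y); the remainders g start with a zero vector, so
   the induction hypothesis covers them. *)
pose Y := \sum_(i < n.+1) c i *: y i.
have -> : \sum_(i < n.+1) \sum_(j < n.+1) f (star (y i) * y j) * inner (h j) (h i) =
    f (star Y * Y) +
    \sum_(i < n.+1) \sum_(j < n.+1) f (star (y i) * y j) * inner (g j) (g i).
  rewrite star_sum mulr_suml functional_sum -big_split /=; apply: eq_bigr => i _.
  rewrite mulr_sumr functional_sum -big_split /=; apply: eq_bigr => j _.
  rewrite gE mulrDr starZ -scalerAl -scalerAr scalerA (functionalZ flin); congr (_ + _).
  ring.
by rewrite addr_ge0 ?ih0 // fpos //; exact: cnonneg_starM.
Qed.

Lemma scalar_completely_positive :
  completely_positive (fun (x : C) (h : H) => f x *: h).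
Proof.
split=> [k x y|x|n X [Y ->] h].
- by apply/funext => h; rewrite flin scalerDl -scalerA.
- split=> [k h l|h]; first by rewrite scalerDr !scalerA mulrC.
  exact: scaler_continuous.
(* The positive matrix is split into one Gram matrix for each row k of [Y]. *)
have -> : \sum_(i < n) \sum_(j < n) inner (f (((map_mx star Y)^T *m Y) i j) *: h j) (h i)
  = \sum_(k < n) \sum_(i < n) \sum_(j < n) f (star (Y k i) * Y k j) * inner (h j) (h i).
  rewrite [RHS]exchange_big /=; apply: eq_bigr => i _.
  rewrite [RHS]exchange_big /=; apply: eq_bigr => j _.
  rewrite innerZl mxE functional_sum mulr_suml; apply: eq_bigr => k _.
  by rewrite !mxE.
by apply: sumr_ge0 => k _; exact: gram_pairing_ge0.
Qed.

End ScalarCompletelyPositive.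

(** * Gleason equivalence *)

Section Equivalences.
Variables (R : realType) (C : cstarAlgType R) (A D : set C).
Hypotheses (hA : unital_operator_algebra A) (hD : unital_cstar_subalgebra D).
Hypothesis hDA : D `<=` A.

Definition strict_kernel_bound (Phi Psi : C -> C) : Prop :=
  exists k : R, [/\ 0 <= k, k < 1 & kernel_bound A Phi Psi k].

Section Pair.
Variables Phi Psi : C -> C.
Hypotheses (hPhi : D_character A D Phi) (hPsi : D_character A D Psi).

Lemma strict_kernel_bound_diff : strict_kernel_bound Phi Psi ->
  exists m : R, [/\ 0 <= m, m < 2 &
    forall a, A a -> normR a <= 1 -> normR (Phi a - Psi a) <= m].
Proof.
move=> [k [k0 k1 hk]].
pose K := 2 + 2 / (1 + 4 * (1 - k ^+ 2)).
have k2 : k ^+ 2 < 1 by rewrite expr_lt1.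
have d0 : 1 < 1 + 4 * (1 - k ^+ 2) by lra.
have K4 : K < 4.
  by rewrite /K -ltrBrDl ltr_pdivrMr; lra.
exists (Num.sqrt K); split; first exact: sqrtr_ge0.
  have -> : 2 = Num.sqrt 4 :> R.
    by rewrite -[2](ger0_norm (_ : 0 <= 2 :> R)) // -sqrtr_sqr; congr Num.sqrt; ring.
  by rewrite ltr_sqrt.
move=> a Aa; rewrite -ler_normR rmorph1 => a1.
apply: (@normR_ball_open R C A (fun a => Phi a - Psi a) _ _ _ _ a Aa) => //.
- by move=> t b; exact: subalgZ.
- by move=> t b Ab; rewrite (dcharZ hA hD hPhi _ Ab) (dcharZ hA hD hPsi _ Ab) scalerBr.
- move=> b Ab b1.
  rewrite -(ger0_norm (normR_ge0 (Phi b - Psi b))) -sqrtr_sqr ler_sqrt.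
    exact: (kernel_bound_diff hA hD hDA hPhi hPsi k0 k1 hk).
  by rewrite addr_ge0 // divr_ge0 //; lra.
Qed.

Lemma opnorm_diff_lt2P :
  (opnorm_on A (fun a => Phi a - Psi a)%R < 2%:E)%E <-> strict_kernel_bound Phi Psi.
Proof.
split=> [/(opnorm_on_bound (ltr0Sn _ _))[m [m0 m2 hm]]|].
  exists (Num.sqrt (m / (1 + m ^+ 2 / 4))); split; first exact: sqrtr_ge0.
    rewrite -[ltRHS]sqrtr1 ltr_sqrt // ltr_pdivrMr ?mul1r; first by nra.
    by rewrite ltr_pwDl // divr_ge0 // sqr_ge0.
  apply: (diff_bound_kernel hA hD hDA hPhi hPsi) => // a Aa a1.
  by apply: hm => //; rewrite normRE lecR.
move=> /strict_kernel_bound_diff[m [m0 m2 hm]].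
apply: (opnorm_on_lt m2) => a Aa; rewrite -[1]/(1%:C) ler_normR; exact: hm.
Qed.

Lemma opnorm_kernel_lt1P :
  (opnorm_on (A `&` [set a | Psi a = 0%R]) Phi < 1%:E)%E <-> strict_kernel_bound Phi Psi.
Proof.
split=> [/(opnorm_on_bound ltr01)[k [k0 k1 hk]]|[k [k0 k1 hk]]].
  exists k; split => // a Aa a0 a1; apply: hk => //.
  by rewrite normRE lecR.
apply: (opnorm_on_lt k1) => a [Aa a0]; rewrite -[1]/(1%:C) ler_normR; exact: hk.
Qed.

End Pair.

Lemma strict_kernel_bound_sym Phi Psi :
  D_character A D Phi -> D_character A D Psi ->
  strict_kernel_bound Phi Psi -> strict_kernel_bound Psi Phi.
Proof.
move=> hPhi hPsi /(strict_kernel_bound_diff hPhi hPsi)[m [m0 m2 hm]].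
apply/(opnorm_diff_lt2P hPsi hPhi)/(opnorm_on_lt m2) => a Aa.
by rewrite -[1]/(1%:C) ler_normR normR_distrC; exact: hm.
Qed.

Section Scalar.
Variables Phi Psi : C -> C.
Hypotheses (hPhi : D_character A D Phi) (hPsi : D_character A D Psi).
Hypothesis D1 : one_dimensional D.

Lemma scalar_character Theta : D_character A D Theta ->
  exists theta : C -> R[i], forall a, A a -> Theta a = theta a *: 1.
Proof.
move=> hT.
have ex a : exists t : R[i], A a -> Theta a = t *: 1.
  have [Aa|nAa] := pselect (A a); last by exists 0.
  have [t tE] := one_dimensional_scalar hD D1 (dchar_codom hT Aa).
  by exists t.
by have [t tE] := choice ex; exists t.
Qed.

Lemma scalar_character_linear Theta (theta : C -> R[i]) : D_character A D Theta ->
  (forall a, A a -> Theta a = theta a *: 1) ->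
  forall k a b, A a -> A b -> theta (k *: a + b) = k * theta a + theta b.
Proof.
move=> hT tE k a b Aa Ab; apply: (@scaler_one_inj R C).
rewrite -tE; last exact: subalg_lin.
by rewrite (dchar_linear hT) // !tE // scalerDl scalerA.
Qed.

Lemma strict_kernel_bound_Re Theta1 Theta2 (theta1 theta2 : C -> R[i]) :
  D_character A D Theta1 -> D_character A D Theta2 ->
  (forall a, A a -> Theta1 a = theta1 a *: 1) ->
  (forall a, A a -> Theta2 a = theta2 a *: 1) ->
  strict_kernel_bound Theta1 Theta2 ->
  exists c : R, 1 < c /\ forall a, A a -> cnonneg (a + star a) ->
    0 <= complex.Re (c%:C * theta2 a - theta1 a).
Proof.
move=> h1 h2 t1 t2 [k [k0 k1 hk]].
pose K := 2 * (1 + k ^+ 2) / (1 - k ^+ 2).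
have K0 : 0 <= K.
  by rewrite divr_ge0 ?subr_ge0 ?expr_le1 ?(ltW k1) // mulr_ge0 // addr_ge0 // sqr_ge0.
(* Enlarging K is free because Re (theta2 a) >= 0; constants above 1 ensure c d > 1 when the two
   inequalities are solved for the characters. *)
exists (K + 2); split; first lra.
move=> a Aa apos.
have le := kernel_bound_harnack hA hD h1 h2 k0 k1 hk Aa apos (t1 a Aa) (t2 a Aa).
have ge := accretive_Re_ge0 hA hD h2 Aa apos (t2 a Aa).
have -> : complex.Re ((K + 2)%:C * theta2 a - theta1 a) =
    (K + 2) * complex.Re (theta2 a) - complex.Re (theta1 a).
  by case: (theta1 a) (theta2 a) => [u v] [u' v'] /=; ring.
by move: le; rewrite -/K => le; rewrite mulrDl; lra.
Qed.

Lemma real_positive_scalar (c : R) (theta1 theta2 : C -> R[i]) Theta1 Theta2 :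
  (forall a, A a -> Theta1 a = theta1 a *: 1) ->
  (forall a, A a -> Theta2 a = theta2 a *: 1) ->
  (forall a, A a -> cnonneg (a + star a) ->
    0 <= complex.Re (c%:C * theta2 a - theta1 a)) ->
  real_positive_on A (fun a => c%:C *: Theta2 a - Theta1 a).
Proof.
move=> t1 t2 hc a Aa apos; rewrite t1 // t2 //.
have := hc a Aa apos; set z := c%:C * theta2 a - theta1 a => z0.
have -> : c%:C *: (theta2 a *: 1) - theta1 a *: 1 = z *: (1 : C).
  by rewrite /z; ncalg; ring.
rewrite starZ star1 -scalerDl.
have -> : z + Num.conj z = (2 * complex.Re z)%:C.
  by rewrite rmorphM /= rmorph_nat -addcJ.
by apply: cnonneg_real; rewrite mulr_ge0.
Qed.

Lemma scalar_harnack_equivalent : strict_kernel_bound Phi Psi ->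
  harnack_equivalent A Phi Psi.
Proof.
move=> kb; have kb' := strict_kernel_bound_sym hPhi hPsi kb.
have [phi phiE] := scalar_character hPhi; have [psi psiE] := scalar_character hPsi.
have [c [c1 hc]] := strict_kernel_bound_Re hPhi hPsi phiE psiE kb.
have [d [d1 hd]] := strict_kernel_bound_Re hPsi hPhi psiE phiE kb'.
exists c, d; split; [lra|lra| |].
  exact: real_positive_scalar hc.
exact: real_positive_scalar hd.
Qed.

(* Extending [c Psi - Phi] and [d Phi - Psi] to positive [mu], [nu] on the whole of
   [C] and solving for [Phi], [Psi] gives [(mu + c nu) / (c d - 1)] and
   [(d mu + nu) / (c d - 1)]. *)
Lemma scalar_cp_harnack_equivalent (H : hilbertType R) (pi : C -> H -> H) :
  represented_nondegenerately D pi -> strict_kernel_bound Phi Psi ->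
  cp_harnack_equivalent A pi Phi Psi.
Proof.
move=> hpi kb; have kb' := strict_kernel_bound_sym hPhi hPsi kb.
have [phi phiE] := scalar_character hPhi; have [psi psiE] := scalar_character hPsi.
have phil := scalar_character_linear hPhi phiE.
have psil := scalar_character_linear hPsi psiE.
have [c [c1 hc]] := strict_kernel_bound_Re hPhi hPsi phiE psiE kb.
have [d [d1 hd]] := strict_kernel_bound_Re hPsi hPhi psiE phiE kb'.
have lin1 (k : R[i]) a b : A a -> A b ->
    c%:C * psi (k *: a + b) - phi (k *: a + b) =
    k * (c%:C * psi a - phi a) + (c%:C * psi b - phi b).
  by move=> Aa Ab; rewrite phil // psil //; ring.
have lin2 (k : R[i]) a b : A a -> A b ->
    d%:C * phi (k *: a + b) - psi (k *: a + b) =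
    k * (d%:C * phi a - psi a) + (d%:C * phi b - psi b).
  by move=> Aa Ab; rewrite phil // psil //; ring.
have [mu [mul muE mupos]] := positive_extension hA lin1 hc.
have [nu [nul nuE nupos]] := positive_extension hA lin2 hd.
have cd0 : 0 < c * d - 1 by nra.
pose q := (c * d - 1)^-1.
have q0 : 0 <= q by rewrite invr_ge0 ltW.
have qE : q%:C * (c%:C * d%:C - 1) = 1.
  rewrite -rmorphM -[1 in X in _ * X](rmorph1 (real_complex R)) -rmorphB -rmorphM.
  by rewrite mulVf ?gt_eqF // rmorph1.
pose phi' x := q%:C * (mu x + c%:C * nu x).
pose psi' x := q%:C * (d%:C * mu x + nu x).
have phi'l (k : R[i]) x y : phi' (k *: x + y) = k * phi' x + phi' y.
  by rewrite /phi' mul nul; ring.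
have psi'l (k : R[i]) x y : psi' (k *: x + y) = k * psi' x + psi' y.
  by rewrite /psi' mul nul; ring.
have c0 : 0 <= c%:C by rewrite ler0c; lra.
have d0 : 0 <= d%:C by rewrite ler0c; lra.
have phi'pos x : cnonneg x -> 0 <= phi' x.
  move=> x0; rewrite mulr_ge0 ?ler0c // addr_ge0 ?mupos //.
  by rewrite mulr_ge0 // nupos.
have psi'pos x : cnonneg x -> 0 <= psi' x.
  move=> x0; rewrite mulr_ge0 ?ler0c // addr_ge0 ?nupos //.
  by rewrite mulr_ge0 // mupos.
have phi'E a : A a -> phi' a = phi a.
  move=> Aa; rewrite /phi' muE // nuE // -[RHS]mul1r -qE; ring.
have psi'E a : A a -> psi' a = psi a.
  move=> Aa; rewrite /psi' muE // nuE // -[RHS]mul1r -qE; ring.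
have pi_scalar (z : R[i]) : pi (z *: 1) = (fun h => z *: h).
  apply/funext => h; rewrite (repZ hD hpi) ?(rep1 hD hpi) //.
  exact: (subalg1 (proj1 hD)).
exists c, d, (fun x h => phi' x *: h), (fun x h => psi' x *: h); split.
- by split; lra.
- by split; exact: scalar_completely_positive.
- by move=> a Aa; rewrite phiE // psiE // !pi_scalar phi'E // psi'E.
- move=> x x0 h.
  rewrite -[(c%:C *: _ - _) h]/(c%:C *: (psi' x *: h) - phi' x *: h).
  have -> : c%:C *: (psi' x *: h) - phi' x *: h = mu x *: h.
    rewrite scalerA -scalerBl; congr (_ *: _).
    by rewrite /phi' /psi' -[RHS]mul1r -qE; ring.
  by rewrite innerZl inner_sqr mulr_ge0 ?mupos // ler0c sqr_ge0.
- move=> x x0 h.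
  rewrite -[(d%:C *: _ - _) h]/(d%:C *: (phi' x *: h) - psi' x *: h).
  have -> : d%:C *: (phi' x *: h) - psi' x *: h = nu x *: h.
    rewrite scalerA -scalerBl; congr (_ *: _).
    by rewrite /phi' /psi' -[RHS]mul1r -qE; ring.
  by rewrite innerZl inner_sqr mulr_ge0 ?nupos // ler0c sqr_ge0.
Qed.

End Scalar.

End Equivalences.

Theorem theorem5p3 (R : realType) (C : cstarAlgType R) (A D : set C)
    (Phi Psi : C -> C)
    (hA : unital_operator_algebra A)
    (hD : unital_cstar_subalgebra D) (hDA : D `<=` A)
    (hPhi : D_character A D Phi) (hPsi : D_character A D Psi) :
  [<-> (opnorm_on A (fun a => Phi a - Psi a)%R < 2%:E)%E;
       (opnorm_on (A `&` [set a | Psi a = 0%R]) Phi < 1%:E)%E;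
       exists2 M : R, 0 < M &
         forall a, A a -> `|a| < 1 -> hyp_dist (Phi a) (Psi a) <= M;
       forall a : nat -> C, (forall n, A (a n) /\ `|a n| <= 1) ->
         (normR (Phi (a n)) @[n --> \oo] --> (1 : R)) ->
         (normR (Psi (a n)) @[n --> \oo] --> (1 : R))]
  /\
  forall (H : hilbertType R) (pi : C -> H -> H),
    represented_nondegenerately D pi ->
    [/\ cp_harnack_equivalent A pi Phi Psi ->
          (opnorm_on A (fun a => Phi a - Psi a)%R < 2%:E)%E,
        harnack_equivalent A Phi Psi ->
          (opnorm_on A (fun a => Phi a - Psi a)%R < 2%:E)%E &
        one_dimensional D ->
          (cp_harnack_equivalent A pi Phi Psi <->
             (opnorm_on A (fun a => Phi a - Psi a)%R < 2%:E)%E) /\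
          (harnack_equivalent A Phi Psi <->
             (opnorm_on A (fun a => Phi a - Psi a)%R < 2%:E)%E)].
Proof.
have diffP := opnorm_diff_lt2P hA hD hDA hPhi hPsi.
split.
  tfae.
  - by move=> /diffP/opnorm_kernel_lt1P.
  - move=> /opnorm_kernel_lt1P/(strict_kernel_bound_sym hA hD hDA hPhi hPsi).
    (* The summand 1 keeps the constant positive when k = 0. *)
    move=> [k [k0 k1 hk]]; exists (atanh k + 1).
      rewrite ltr_wpDl //; apply: le_trans (atanh_le (lexx 0) k0 k1).
      by rewrite /atanh addr0 subr0 divr1 ln1 mul0r.
    move=> a Aa; rewrite -[1]/(1%:C) ltr_normR => a1.
    apply: le_trans (kernel_bound_hyp_dist hA hD hDA hPhi hPsi k0 k1 hk Aa a1) _.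
    by rewrite lerDl.
  - move=> [M M0 hM].
    have kb : strict_kernel_bound A Phi Psi.
      apply: (strict_kernel_bound_sym hA hD hDA hPsi hPhi).
      have e1 : 1 < expR (2 * M) by rewrite expR_gt1 mulr_gt0.
      exists ((expR (2 * M) - 1) / (expR (2 * M) + 1)); split.
      + by rewrite divr_ge0 //; lra.
      + by rewrite ltr_pdivrMr; lra.
      apply: (hyp_dist_kernel_bound hA hD hPhi hPsi) => a Aa a1; apply: hM => //.
      by rewrite -[1]/(1%:C) ltr_normR.
    move: kb => [k [k0 k1 hk]] a.
    exact: (kernel_bound_cvg hA hD hDA hPhi hPsi k0 k1 hk).
  - by move=> /(cvg_kernel_bound hPhi)/diffP.
move=> H pi hpi.
have h5 : cp_harnack_equivalent A pi Phi Psi ->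
    (opnorm_on A (fun a => Phi a - Psi a)%R < 2%:E)%E.
  by move=> /(cp_harnack_kernel_bound hA hD hDA hPhi hPsi hpi)/diffP.
have h6 : harnack_equivalent A Phi Psi ->
    (opnorm_on A (fun a => Phi a - Psi a)%R < 2%:E)%E.
  move=> [c [d [_ d0 _ hd]]].
  exact/diffP/(harnack_kernel_bound hA hD hDA hPhi hPsi d0 hd).
split => // D1; split; split => //.
  by move=> /diffP; exact: (scalar_cp_harnack_equivalent hA hD hDA hPhi hPsi D1 hpi).
by move=> /diffP; exact: (scalar_harnack_equivalent hA hD hDA hPhi hPsi D1).
Qed.
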